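(* Let $\sigma\in S_3$, and for each $n\ge 4$ let $\Pi^\sigma_n$ be a uniformly random element of $\mathbf{Av}_n(\sigma)$, regarded as a random element of $F(\mathbb{N},\mathbb{N}^* )$. Then there exists an $F(\mathbb{N},\mathbb{N}^* )$-valued random variable $\Pi^\sigma$ such that $\Pi^\sigma_n$ converges in distribution to $\Pi^\sigma$ as $n\to\infty$.
   Context: $\mathbb{N}=\{1,2,\dots\}$ and $[n]=\{1,\dots,n\}$. $S_n$ is the set of permutations of $[n]$. For $n>m$, a permutation $\pi\in S_n$ contains $\sigma\in S_m$ if there are indices $i_1<\dots<i_m$ in $[n]$ such that for all $j<k$, $\pi(i_j)<\pi(i_k)$ if and only if $\sigma(j)<\sigma(k)$; otherwise $\pi$ avoids $\sigma$. $\mathbf{Av}_n(\sigma)$ is the set of $\pi\in S_n$ avoiding $\sigma$. $\mathbb{N}^*=\mathbb{N}\cup\{\infty\}$ is the one-point compactification of $\mathbb{N}$ (with the discrete topology), and $F(\mathbb{N},\mathbb{N}^* )$ is the set of functions $\mathbb{N}\to\mathbb{N}^*$ with the topology of pointwise convergence (and its Borel $\sigma$-algebra). $S_n$ is embedded in $F(\mathbb{N},\mathbb{N}^* )$ by setting $\pi(k)=k$ for $k>n$. *)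

(* Defs.v *)
From HB Require Import structures.
From mathcomp Require Import all_boot all_order all_algebra all_fingroup.
From mathcomp Require Import all_classical all_reals all_analysis.

Set Implicit Arguments.
Unset Strict Implicit.
Unset Printing Implicit Defensive.

Import Order.TTheory GRing.Theory Num.Theory.
Import numFieldNormedType.Exports.

Local Open Scope classical_set_scope.
Local Open Scope ring_scope.

(* Indexing convention: [n] = {1, ..., n} is 'I_n = {0, ..., n-1} and
   N = {1, 2, ...} is nat = {0, 1, ...}, so that arguments and values of
   permutations, and of functions N -> N^*, are all shifted down by one. *)

Definition perm_contains (n m : nat) (pi : 'S_n) (sigma : 'S_m) : bool :=
  [exists i : {ffun 'I_m -> 'I_n}, forall j : 'I_m, forall k : 'I_m,
    (j < k)%N ==>
      (i j < i k)%N && ((pi (i j) < pi (i k))%N == (sigma j < sigma k)%N)].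

Definition Av (n m : nat) (sigma : 'S_m) : {set 'S_n} :=
  [set pi : 'S_n | ~~ perm_contains pi sigma].

HB.instance Definition _ (I : Type) (E : I -> ptopologicalType) :=
  isPointed.Build (prod_topology E) (fun=> point).

(* [None] is the point at infinity. *)
Notation Nstar := (one_point_compactification nat).

Notation FNN := {ptws nat -> Nstar}.

Definition borel (E : ptopologicalType) := g_sigma_algebraType (@open E).
HB.instance Definition _ (E : ptopologicalType) := Measurable.on (borel E).

(* Permutations carry the discrete sigma-algebra. The instances are on
   [perm_type], to which {perm T} and 'S_n unfold. *)
HB.instance Definition _ (T : finType) := isPointed.Build (perm_type T) 1%g.
HB.instance Definition _ (T : finType) :=
  @isMeasurable.Build default_measure_display (perm_type T)
    (@discrete_measurable _) (@discrete_measurable0 _)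
    (@discrete_measurableC _) (@discrete_measurableU _).

Definition perm_fun (n : nat) (pi : 'S_n) : borel FNN :=
  fun k => Some (if insub k is Some i then nat_of_ord (pi i) else k).

Local Lemma measurable_perm_fun (n : nat) : measurable_fun setT (@perm_fun n).
Proof. by []. Qed.

HB.instance Definition _ (n : nat) :=
  isMeasurableFun.Build _ _ _ _ (@perm_fun n) (@measurable_perm_fun n).

Definition uniform_on (R : realType) (n : nat) (d : measure_display)
    (T : measurableType d) (P : probability T R) (X : {RV P >-> 'S_n})
    (A : {set 'S_n}) : Prop :=
  forall pi : 'S_n, distribution P X [set pi] =
    (if pi \in A then (#|A|%:R)^-1 else 0)%:E.

(* Convergence in distribution of random elements of a topological space,
   possibly defined on different probability spaces: convergence of the
   expectations of all bounded continuous real functions. *)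
Definition cvg_in_distribution (R : realType) (E : ptopologicalType)
    (d : nat -> measure_display) (T : forall n, measurableType (d n))
    (P : forall n, probability (T n) R) (X : forall n, {RV P n >-> borel E})
    (d' : measure_display) (T' : measurableType d') (P' : probability T' R)
    (Y : {RV P' >-> borel E}) : Prop :=
  forall f : E -> R, continuous f -> bounded_fun f ->
    'E_(P n)[f \o X n]%E @[n --> \oo] --> 'E_P'[f \o Y]%E.

(* Main.v *)
Require Import Defs.
From HB Require Import structures.
From mathcomp Require Import all_boot all_order all_algebra all_fingroup.
From mathcomp Require Import all_classical all_reals all_analysis.
From mathcomp Require Import zify ring lra measurable_realfun.

(** Why the theorem holds.

The space of functions from N to N^* is compact, and its topology is generated
by the clopen events x i = a with a finite. Hence a sequence of random elements
converges in distribution as soon as the probability of every cylinder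
{x | x i = a for all (i, a) in m}, with m a finite list, converges
([cvg_in_distribution_of_cylinders]): a continuous function is uniformly
approximated by functions of finitely many of these events, and the limit
probabilities are consistent, so that nested subintervals of [0, 1[ whose
lengths are these probabilities define a random variable with the limit law.
It remains to prove an enumerative statement ([Av_matches_cvg]): for every
sigma and m, the proportion of sigma-avoiders pi such that pi i = a for all
(i, a) in m converges.

Complement, reverse and inverse reduce the six patterns to 312 and 321
([sum_Av_cases]). Let the run of an avoider of 312 be the largest s such that
the values 0, ..., s - 1 occur in decreasing order (for 321: in increasing
order). A new first value a can be inserted exactly when a <= s, and the s + 1
permutations so obtained have runs 1, ..., s + 1, each exactly once, for both
patterns ([Av3_front], [run_front]). Therefore the sum of w (run pi) over the
avoiders of size n is (T^n w)(0), where (T w)(s) = w 1 + ... + w (s + 1), and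
the number of avoiders is the Catalan number c_n = (T^n 1)(0).

The analytic core is [ratio_cvg_descendants]: (T^n w)(s) / c_n converges for
every s and every w of polynomial growth. For thresholds w = [s >= t] this
follows from the recurrence T [s >= t + 1] - T [s >= t + 2] = [s >= t] and from
c_(n+1) / c_n --> 4; cutting w at a large N costs only O(1 / N) * c_n, because
T^n applied to (s + 1)^d is O(c_(n+d)) = O(c_n). No asymptotic estimate of the
Catalan numbers themselves enters.

Three kinds of cylinders then have to be treated.
- First positions of 312- and 321-avoiders (patterns 312, 321, and 231 by
  inversion): removing the first value p times turns a function of the first p
  values and of the run into a function of the run alone, of polynomial growth
  ([avsum_take_cvg]).
- Complements (patterns 123 and 132): a small value of the complement is a
  value of pi close to n, and the mean of pi i over the avoiders is bounded, so
  every nonempty cylinder has limit probability 0 ([avsum_complement_cvg]).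
- Last positions of 312-avoiders (pattern 213, by reversal): if v is the
  largest prescribed value, inserting a first value a < v lowers v, a = v is
  impossible, and a > v leaves the constraints unchanged while T acts on runs
  counted from v + 1 ([avsum_rev_matches_cvg]). *)

Set Implicit Arguments.
Unset Strict Implicit.
Unset Printing Implicit Defensive.
Import Order.TTheory GRing.Theory Num.Theory.
Import numFieldNormedType.Exports.
Local Open Scope classical_set_scope.
Local Open Scope ring_scope.

(** * The Catalan operator *)

Section CatalanOperator.
Variable R : realType.
Implicit Types (w : nat -> R) (u : nat -> R).

(** An avoider with run s has one child of each run 1, ..., s + 1; this operator
sums a weight over the children. *)
Definition children_sum w : nat -> R := fun s => \sum_(j < s.+1) w j.+1.

(** The sum of the weight over the k-th generation below a node of run s; the
iterates of one linear operator replace all generating functions here. *)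
Definition descendants k w : nat -> R := iter k children_sum w.

Definition catalan k : R := descendants k (fun=> 1) 0.

Lemma descendantsS k w : descendants k.+1 w = children_sum (descendants k w).
Proof. by []. Qed.

Lemma descendantsSr k w : descendants k.+1 w = descendants k (children_sum w).
Proof. by rewrite /descendants iterSr. Qed.

Lemma children_sumS w s : children_sum w s.+1 = children_sum w s + w s.+2.
Proof. by rewrite /children_sum big_ord_recr. Qed.

Lemma children_sum0 w : children_sum w 0 = w 1.
Proof. by rewrite /children_sum big_ord1. Qed.

Lemma descendants_lin k a w1 w2 :
  descendants k (fun s => a * w1 s + w2 s) =
  (fun s => a * descendants k w1 s + descendants k w2 s).
Proof.
elim: k => //= k IH; rewrite /descendants /= -/(descendants _ _) IH.
apply/funext => s; rewrite /children_sum mulr_sumr -big_split /=.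
by apply: eq_bigr => j _.
Qed.

Lemma descendants_le k w1 w2 : (forall s, w1 s <= w2 s) ->
  forall s, descendants k w1 s <= descendants k w2 s.
Proof.
move=> le12; elim: k => //= k IH s.
by apply: ler_sum => j _; exact: IH.
Qed.

Lemma descendantsZ k a w s : descendants k (fun s => a * w s) s = a * descendants k w s.
Proof.
have := congr1 (fun f => f s) (descendants_lin k a w (fun=> 0)).
rewrite /=; under [in descendants _ _]eq_fun do rewrite addr0.
move=> ->; suff -> : descendants k (fun=> 0) = (fun=> 0) by rewrite addr0.
elim: k => //= k IH; rewrite /descendants /= -/(descendants _ _) IH.
by apply/funext => t; rewrite /children_sum big1.
Qed.

Lemma descendantsD k w1 w2 s :
  descendants k (fun s => w1 s + w2 s) s = descendants k w1 s + descendants k w2 s.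
Proof.
have := congr1 (fun f => f s) (descendants_lin k 1 w1 w2).
by rewrite /=; under [in descendants _ _]eq_fun do rewrite mul1r; rewrite mul1r.
Qed.

Lemma descendantsB k w1 w2 s :
  descendants k (fun s => w1 s - w2 s) s = descendants k w1 s - descendants k w2 s.
Proof.
rewrite -mulN1r -descendantsZ -descendantsD.
by congr descendants; apply/funext => t; rewrite mulN1r.
Qed.

Lemma descendants_abs k w1 w2 : (forall s, `|w1 s| <= w2 s) ->
  forall s, `|descendants k w1 s| <= descendants k w2 s.
Proof.
move=> le12; elim: k => //= k IH s.
apply: le_trans (ler_norm_sum _ _ _) _.
by apply: ler_sum => j _; exact: IH.
Qed.

(** The iterates of the constant 1 are the ballot numbers: both sides satisfy the
recurrence in s of [children_sumS], which is Pascal's rule on the right. *)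
Lemma descendants_ballot k s : descendants k (fun=> 1) s =
  'C(2 * k + s, k)%:R - (if k is k'.+1 then 'C(2 * k + s, k') else 0)%:R.
Proof.
elim: k s => [|k IH] s; first by rewrite /descendants /= bin0 subr0.
rewrite descendantsS; elim: s => [|s IHs].
  rewrite children_sum0 IH addn0 addn1 mulnS add2n.
  have symm : 'C((2 * k).+1, k.+1) = 'C((2 * k).+1, k).
    by rewrite -bin_sub ?mul2n ?subSS -?addnn ?addnK ?ltnS ?leq_addr.
  rewrite binS symm; case: k {IH} symm => [|k] symm; first by rewrite !bin0; lra.
  by rewrite [in X in _ = _ - X]binS !natrD; lra.
rewrite children_sumS IHs IH !mulnS !add2n !addSn !addnS.
rewrite [in RHS]binS; case: k {IH IHs} => [|k]; first by rewrite !bin0 !bin1; lra.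
by rewrite [in X in _ = _ - X]binS !natrD; lra.
Qed.

Lemma catalan_central k : catalan k * k.+1%:R = 'C(2 * k, k)%:R.
Proof.
rewrite /catalan descendants_ballot addn0; case: k => [|k]; first by rewrite subr0 mulr1.
have := mul_bin_left (2 * k.+1) k.
have -> : (2 * k.+1 - k = k.+2)%N by lia.
move=> /(congr1 (fun n => n%:R : R)); rewrite !natrM => e.
have -> : k.+2%:R = k.+1%:R + 1 :> R by rewrite -natr1.
rewrite mulrBl mulrDr mulr1 mulrC e; lra.
Qed.

Lemma catalan_gt0 k : 0 < catalan k.
Proof.
rewrite -(@pmulr_lgt0 _ k.+1%:R) ?ltr0n// catalan_central ltr0n bin_gt0; lia.
Qed.

(** The two-term recurrence of the central binomial coefficients, in a form from
which the limit of the ratio of consecutive Catalan numbers can be read off. *)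
Lemma catalanS k : catalan k.+1 * k.+2%:R = (4 * k + 2)%:R * catalan k.
Proof.
apply: (@mulfI _ k.+1%:R); first by rewrite pnatr_eq0.
rewrite mulrCA [RHS]mulrCA [k.+1%:R * catalan k]mulrC catalan_central.
rewrite mulrCA catalan_central -!natrM; congr (_%:R).
rewrite mulnS add2n; have /= := mul_bin_diag (2 * k).+2 k.
have /= := mul_bin_down (2 * k).+1 k.
have -> : ((2 * k).+1 - k = k.+1)%N by lia.
nia.
Qed.

Lemma catalan_neq0 k : catalan k != 0.
Proof. exact: lt0r_neq0 (catalan_gt0 k). Qed.

Lemma catalan_ratioE n : catalan n.+1 / catalan n = 4 - 6 * harmonic n.+1 :> R.
Proof.
rewrite /harmonic /=; apply: (@mulIf _ (catalan n)); first exact: catalan_neq0.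
rewrite divfK ?catalan_neq0//.
apply: (@mulIf _ n.+2%:R); first by rewrite pnatr_eq0.
rewrite catalanS mulrAC mulrBl -mulrA mulVf ?pnatr_eq0//.
by rewrite -[n.+2]addn2 [(4 * n + 2)%:R]natrD [(n + 2)%:R]natrD natrM; ring.
Qed.

Lemma catalan_ratio_cvg : (catalan n.+1 / catalan n) @[n --> \oo] --> (4 : R).
Proof.
under eq_fun do rewrite catalan_ratioE.
have h0 : (harmonic n.+1 : R) @[n --> \oo] --> 0.
  by rewrite (cvg_shiftS (@harmonic R)); exact: cvg_harmonic.
have := cvgB (cvg_cst (4 : R)) (cvgM (cvg_cst (6 : R)) h0).
rewrite mulr0 subr0; apply.
Qed.

Lemma catalan_ratio_le n : catalan n.+1 <= 4 * catalan n.
Proof.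
rewrite -ler_pdivrMr ?catalan_gt0// catalan_ratioE lerBlDr lerDl mulr_ge0//.
by rewrite /harmonic /= invr_ge0.
Qed.

Lemma catalan_shift_le d n : catalan (n + d) <= 4 ^+ d * catalan n.
Proof.
elim: d => [|d IH]; first by rewrite addn0 mul1r.
rewrite addnS (le_trans (catalan_ratio_le _))// exprS -mulrA.
by rewrite ler_wpM2l.
Qed.

(** The scale on which everything is measured: u has a limiting proportion among
the avoiders of size n. *)
Definition ratio_cvg u := cvgn (fun n => u n / catalan n).

Lemma ratio_cvg_catalan : ratio_cvg catalan.
Proof.
rewrite /ratio_cvg; under eq_fun do rewrite divff ?catalan_neq0//.
exact: is_cvg_cst.
Qed.

Lemma ratio_cvgD u v : ratio_cvg u -> ratio_cvg v -> ratio_cvg (fun n => u n + v n).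
Proof.
rewrite /ratio_cvg => cu cv; under eq_fun do rewrite mulrDl.
exact: is_cvgD.
Qed.

Lemma ratio_cvgZ a u : ratio_cvg u -> ratio_cvg (fun n => a * u n).
Proof.
rewrite /ratio_cvg => cu; under eq_fun do rewrite -mulrA.
by apply: is_cvgM => //; exact: is_cvg_cst.
Qed.

Lemma ratio_cvgB u v : ratio_cvg u -> ratio_cvg v -> ratio_cvg (fun n => u n - v n).
Proof.
move=> cu /(@ratio_cvgZ (-1)) cv; have := ratio_cvgD cu cv.
by congr ratio_cvg; apply/funext => n; rewrite mulN1r.
Qed.

Lemma ratio_cvg0 : ratio_cvg (fun=> 0).
Proof.
have := @ratio_cvgZ 0 _ ratio_cvg_catalan.
by congr ratio_cvg; apply/funext => n; rewrite mul0r.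
Qed.

Lemma ratio_cvg_eventually N u v : (forall n, (N <= n)%N -> u n = v n) ->
  ratio_cvg u -> ratio_cvg v.
Proof.
move=> uv cu; apply: (cvgP _ (cvg_trans _ cu)); apply: near_eq_cvg.
by exists N => // n /= Nn; rewrite uv.
Qed.

Lemma ratio_cvg_sum (I : Type) (r : seq I) (P : pred I) (F : I -> nat -> R) :
  (forall i, P i -> ratio_cvg (F i)) ->
  ratio_cvg (fun n => \sum_(i <- r | P i) F i n).
Proof.
move=> cF; elim: r => [|i r IH].
  by apply: (ratio_cvg_eventually (N := 0)) ratio_cvg0 => n _; rewrite big_nil.
have [Pi|/negPf nPi] := boolP (P i).
  apply: (ratio_cvg_eventually (N := 0)) (ratio_cvgD (cF _ Pi) IH) => n _.
  by rewrite big_cons Pi.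
by apply: (ratio_cvg_eventually (N := 0)) IH => n _; rewrite big_cons nPi.
Qed.

Lemma is_cvg_shiftS u : cvgn (fun n => u n.+1) <-> cvgn u.
Proof.
split=> cu; last by apply: (cvgP (limn u)); rewrite (cvg_shiftS u).
by apply: (cvgP (limn (fun n => u n.+1))); rewrite -(cvg_shiftS u).
Qed.

(** Passing to the next size multiplies the limit by 4. *)
Lemma ratio_cvgS u : ratio_cvg (fun n => u n.+1) <-> ratio_cvg u.
Proof.
have e n : (u n.+1 / catalan n.+1) * (catalan n.+1 / catalan n) = u n.+1 / catalan n.
  by rewrite mulrA divfK ?catalan_neq0.
have n40 : (4 : R) != 0 by [].
have c4 := catalan_ratio_cvg; split => cu.
  apply/is_cvg_shiftS => /=.
  have -> : (fun n => u n.+1 / catalan n.+1) =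
      (fun n => (u n.+1 / catalan n) * (catalan n.+1 / catalan n)^-1).
    by apply/funext => n; rewrite -e mulfK// mulf_neq0 ?invr_eq0 ?catalan_neq0.
  exact: (is_cvgM cu (cvgP _ (cvgV n40 c4))).
rewrite /ratio_cvg; under eq_fun do rewrite -e.
have cuS := (is_cvg_shiftS _).2 cu.
exact: (is_cvgM cuS (cvgP _ c4)).
Qed.

(** A sequence within e * catalan of a convergent one, for every e, has Cauchy
ratios. This is how truncations are removed. *)
Lemma ratio_cvg_approx u :
  (forall e, 0 < e -> exists2 v, ratio_cvg v &
     forall n, `|u n - v n| <= e * catalan n) -> ratio_cvg u.
Proof.
move=> approx; apply: cauchy_cvg; apply/cauchy_exP => e e0.
have e2 : 0 < e / 2 by rewrite divr_gt0.
have [v /cvgrPdist_lt/(_ _ e2) cv uv] := approx _ e2.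
exists (lim ((fun n => v n / catalan n) @ \oo)).
rewrite /= nbhs_filterE; apply: filterS cv => n /= vn.
rewrite /ball /=.
rewrite -(subrKA (v n / catalan n)) (splitr e) (le_lt_trans (ler_normD _ _))//.
rewrite ltr_leD// -mulrBl normrM normfV (gtr0_norm (catalan_gt0 n)).
by rewrite ler_pdivrMr ?catalan_gt0// distrC.
Qed.

Lemma descendants_sum k N (F : nat -> nat -> R) s :
  descendants k (fun s => \sum_(t < N) F t s) s =
  \sum_(t < N) descendants k (F t) s.
Proof.
elim: N => [|N IH].
  under eq_fun do rewrite big_ord0.
  rewrite big_ord0 -[RHS](mul0r (descendants k (fun=> 1) s)) -descendantsZ.
  by congr descendants; apply/funext => t; rewrite mul0r.
under eq_fun do rewrite big_ord_recr /=.
by rewrite descendantsD IH big_ord_recr.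
Qed.

Lemma succ_exp_le (y d : nat) : (y.+1 ^ d.+1 <= y ^ d.+1 + d.+1 * y.+1 ^ d)%N.
Proof.
elim: d => [|d IH]; first by rewrite !expn1 expn0; lia.
rewrite expnS [(y ^ d.+2)%N]expnS.
have : (y * y.+1 ^ d <= y.+1 ^ d.+1)%N by rewrite expnS leq_mul.
move: IH; set a := (y.+1 ^ d.+1)%N; set b := (y.+1 ^ d)%N; set c := (y ^ d.+1)%N.
nia.
Qed.

Lemma exp_le_sum_exp (s d : nat) :
  (s.+1 ^ d.+1 <= d.+1 * \sum_(j < s.+1) j.+1 ^ d)%N.
Proof.
elim: s => [|s IH]; first by rewrite big_ord1 !exp1n; lia.
rewrite big_ord_recr mulnDr /= (leq_trans (succ_exp_le _ _))//.
by rewrite leq_add2r.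
Qed.

(** Each application of the operator raises the degree of growth by one, so a
power (s + 1)^d is controlled by d applications to the constant 1. *)
Lemma exp_le_descendants d s :
  s.+1%:R ^+ d <= d`!%:R * descendants d (fun=> 1) s :> R.
Proof.
elim: d s => [|d IH] s; first by rewrite /descendants /= expr0 mulr1.
have := exp_le_sum_exp s d; rewrite -(ler_nat R) natrX => /le_trans; apply.
rewrite factS !natrM natr_sum -mulrA ler_wpM2l// descendantsS mulr_sumr.
apply: ler_sum => j _; rewrite natrX (le_trans _ (IH _))//.
by rewrite lerXn2r ?nnegrE// ler_nat.
Qed.

(** Weights of polynomial growth have total O(catalan k): by
[exp_le_descendants] the degree d only shifts the Catalan index by d, which
costs a factor 4^d. *)
Lemma descendants_exp_le k d :
  descendants k (fun s => s.+1%:R ^+ d) 0 <= d`!%:R * 4 ^+ d * catalan k.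
Proof.
apply: le_trans (descendants_le k (exp_le_descendants d) 0) _.
rewrite descendantsZ -mulrA ler_wpM2l// (le_trans _ (catalan_shift_le d k))//.
by rewrite /catalan /descendants iterD.
Qed.

Definition threshold t : nat -> R := fun s => (t <= s)%N%:R.

Lemma children_sum_threshold1 : children_sum (threshold 1) = children_sum (fun=> 1).
Proof. by []. Qed.

(** The two sums differ in the single term j = t. Read from right to left, this
expresses the iterates of a threshold by iterates of lower thresholds. *)
Lemma children_sum_thresholdS t s : children_sum (threshold t.+1) s =
  children_sum (threshold t.+2) s + threshold t s.
Proof.
rewrite /children_sum /threshold.
have [ts|st] := leqP t s; last first.
  rewrite addr0; apply: eq_bigr => j _; rewrite !ltnS.
  by congr (_%:R); have := ltn_ord j; lia.
rewrite (bigD1 (Ordinal (_ : t < s.+1)%N)) //=.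
rewrite [in RHS](bigD1 (Ordinal (_ : t < s.+1)%N)) //=.
rewrite !ltnS leqnn ltnn add0r addrC; congr (_ + _).
by apply: eq_bigr => j /eqP/val_eqP /=; rewrite !ltnS ltn_neqAle eq_sym => ->.
Qed.

Lemma ratio_cvg_threshold t : ratio_cvg (fun k => descendants k (threshold t) 0).
Proof.
suff : ratio_cvg (fun k => descendants k (threshold t) 0) /\
  ratio_cvg (fun k => descendants k (threshold t.+1) 0) by case.
elim: t => [|t [IH0 IH1]]; split=> //.
- exact: ratio_cvg_catalan.
- apply/ratio_cvgS.
  apply: (ratio_cvg_eventually (N := 0)) ((ratio_cvgS _).2 ratio_cvg_catalan).
  by move=> n _; rewrite /catalan !descendantsSr children_sum_threshold1.
- apply/ratio_cvgS.
  apply: (ratio_cvg_eventually (N := 0))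
    (ratio_cvgB ((ratio_cvgS _).2 IH1) IH0) => n _.
  rewrite !descendantsSr.
  rewrite (funext (children_sum_thresholdS t)).
  by rewrite descendantsD addrK.
Qed.

Definition poly_bounded w := exists M d, forall s, `|w s| <= M * s.+1%:R ^+ d.

(** Below a cut N the weight is a finite combination of thresholds; above N it is
at most (s + 1)^(d + 1) / (N + 1) up to a constant, which contributes
O(1 / N) * catalan k. *)
Lemma ratio_cvg_root w : poly_bounded w ->
  ratio_cvg (fun k => descendants k w 0).
Proof.
move=> [M [d wM]]; apply: ratio_cvg_approx => e e0.
have M0 : 0 <= M by have := wM 0%N; rewrite expr1n mulr1; apply: le_trans.
set K := M * (d.+1`!%:R * 4 ^+ d.+1).
(* The cut N is so large that the tail contributes at most e * catalan k. *)
have [N NK] : exists N, K <= e * N.+1%:R.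
  exists (Num.truncn (K / e)); rewrite mulrC -ler_pdivrMr//.
  by apply: ltW; exact: truncnS_gt.
pose low t s := w t * (threshold t s - threshold t.+1 s).
exists (fun k => \sum_(t < N) w t * (descendants k (threshold t) 0 -
                                     descendants k (threshold t.+1) 0)).
  apply: ratio_cvg_sum => t _; apply/ratio_cvgZ/ratio_cvgB;
    exact: ratio_cvg_threshold.
move=> k.
pose tail s := w s - \sum_(t < N) low t s.
have -> : descendants k w 0 - \sum_(t < N) w t * (descendants k (threshold t) 0 -
     descendants k (threshold t.+1) 0) = descendants k tail 0.
  rewrite /tail descendantsB descendants_sum; congr (_ - _).
  by apply: eq_bigr => t _; rewrite /low descendantsZ descendantsB.
have tailE s : tail s = if (s < N)%N then 0 else w s.
  have lowE (t : 'I_N) : low t s = if t == s :> nat then w s else 0.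
    rewrite /low /threshold ltn_neqAle; case: eqP => [->|_] /=.
      by rewrite leqnn subr0 mulr1.
    by rewrite subrr mulr0.
  rewrite /tail (eq_bigr _ (fun t _ => lowE t)) -big_mkcond /=.
  case: ltnP => [sN|Ns]; last first.
    by rewrite big1 ?subr0// => t /eqP ts; have := ltn_ord t; lia.
  by rewrite (big_pred1 (Ordinal sN)) ?subrr.
have tail_le s : `|tail s| <= M / N.+1%:R * s.+1%:R ^+ d.+1.
  rewrite tailE; case: ltnP => [sN|Ns].
    by rewrite normr0 mulr_ge0 ?divr_ge0.
  rewrite (le_trans (wM s))// exprS -[leRHS]mulrA ler_wpM2l//.
  by rewrite mulrA ler_peMl// mulrC ler_pdivlMr// mul1r ler_nat.
apply: le_trans (descendants_abs k tail_le 0) _.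
rewrite descendantsZ.
apply: (@le_trans _ _ (M / N.+1%:R * (d.+1`!%:R * 4 ^+ d.+1 * catalan k))).
  by rewrite ler_wpM2l ?divr_ge0// descendants_exp_le.
rewrite mulrA ler_wpM2r ?(ltW (catalan_gt0 _))//.
by rewrite mulrAC ler_pdivrMr.
Qed.

(** From the root to an arbitrary run: the value of T w at s + 1 minus its value at
s is w (s + 2), and T w 0 = w 1, so the values at s + 2 come from those at
smaller runs one generation later. *)
Lemma ratio_cvg_descendants w s : poly_bounded w ->
  ratio_cvg (fun k => descendants k w s).
Proof.
move=> pw; suff : ratio_cvg (fun k => descendants k w s) /\
  ratio_cvg (fun k => descendants k w s.+1) by case.
have cw0 := ratio_cvg_root pw.
elim: s => [|s [IH0 IH1]]; split=> //.
  apply: (ratio_cvg_eventually (N := 0)) ((ratio_cvgS _).2 cw0) => n _.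
  by rewrite descendantsS children_sum0.
have cS := (ratio_cvgS _).2 IH1.
have c0 := (ratio_cvgS _).2 IH0.
apply: (ratio_cvg_eventually (N := 0)) (ratio_cvgB cS c0) => n _.
by rewrite !descendantsS children_sumS addrC addKr.
Qed.

End CatalanOperator.

(** * Generating avoiders of 312 and 321 by their first value *)

Section FrontInsertion.
Implicit Types (e : bool) (n : nat).

(** Avoidance of 312 ([e = true]) and of 321 ([e = false]) at once: the largest
letter comes first, and [e] tells whether the two smaller ones ascend. *)
Definition Av3 e n : {set 'S_n} :=
  [set pi : 'S_n | [forall x : 'I_n, forall y : 'I_n, forall z : 'I_n,
    [&& x < y, y < z, pi y < pi x & pi z < pi x]%N ==>
      ((pi y < pi z)%N != e)]].

Lemma Av3P e n (pi : 'S_n) :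
  reflect (forall x y z : 'I_n, (x < y)%N -> (y < z)%N -> (pi y < pi x)%N ->
             (pi z < pi x)%N -> (pi y < pi z)%N != e)
          (pi \in Av3 e n).
Proof.
rewrite inE; apply: (iffP forallP) => [H x y z xy yz yx zx|H x].
  by have /forallP/(_ y)/forallP/(_ z) := H x; rewrite xy yz yx zx.
apply/forallP => y; apply/forallP => z; apply/implyP => /and4P[].
exact: H.
Qed.

(** Exactly the condition under which a value b put in front creates no
occurrence of the pattern. *)
Definition free_below e n b (pi : 'S_n) : bool :=
  [forall y : 'I_n, forall z : 'I_n,
    [&& y < z, pi y < b & pi z < b]%N ==> ((pi y < pi z)%N != e)].

Lemma free_belowP e n b (pi : 'S_n) :
  reflect (forall y z : 'I_n, (y < z)%N -> (pi y < b)%N ->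
             (pi z < b)%N -> (pi y < pi z)%N != e)
          (free_below e b pi).
Proof.
apply: (iffP forallP) => [H y z yz yb zb|H y].
  by have /forallP/(_ z) := H y; rewrite yz yb zb.
by apply/forallP => z; apply/implyP => /and3P[]; exact: H.
Qed.

Lemma free_belowW e n b b' (pi : 'S_n) : (b' <= b)%N ->
  free_below e b pi -> free_below e b' pi.
Proof.
move=> b'b /free_belowP H; apply/free_belowP => y z yz yb zb.
by apply: H => //; exact: leq_trans b'b.
Qed.

Lemma lt_bump a x y : (bump a x < bump a y)%N = (x < y)%N.
Proof. rewrite /bump; lia. Qed.

Lemma bump_lt a x : (bump a x < a)%N = (x < a)%N.
Proof. rewrite /bump; lia. Qed.

(** [lift_perm ord0 a pi] puts the value a in front of pi, so a new occurrence
of the pattern must use a as its largest letter. *)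
Lemma Av3_front e n (a : 'I_n.+1) (pi : 'S_n) :
  (lift_perm ord0 a pi \in Av3 e n.+1) = (pi \in Av3 e n) && free_below e a pi.
Proof.
apply/Av3P/andP => [H|[/Av3P H /free_belowP Ha] x y z].
  split.
    apply/Av3P => x y z xy yz yx zx.
    have := H (lift ord0 x) (lift ord0 y) (lift ord0 z).
    by rewrite !lift_perm_lift /= !lt_bump; apply.
  apply/free_belowP => y z yz ya za.
  have := H ord0 (lift ord0 y) (lift ord0 z).
  by rewrite lift_perm_id !lift_perm_lift /= !lt_bump !bump_lt; apply.
case: (unliftP ord0 y) => [y'|] -> // xy.
case: (unliftP ord0 z) => [z'|] -> // yz; move: xy yz.
case: (unliftP ord0 x) => [x'|] ->.
  by rewrite !lift_perm_lift /= !lt_bump; exact: H.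
by rewrite lift_perm_id !lift_perm_lift /= !lt_bump !bump_lt => _; exact: Ha.
Qed.

Definition run e n (pi : 'S_n) : nat :=
  \max_(b < n.+1 | free_below e b pi) b.

Lemma free_below_run e n b (pi : 'S_n) : (b <= n)%N ->
  free_below e b pi = (b <= run e pi)%N.
Proof.
rewrite -ltnS => bn; apply/idP/idP => [fb|].
  exact: (leq_bigmax_cond (Ordinal bn) fb).
have /(eq_bigmax_cond (fun b : 'I_n.+1 => b : nat)) :
    (0 < #|[pred b : 'I_n.+1 | free_below e b pi]|)%N.
  by apply/card_gt0P; exists ord0; rewrite inE; apply/free_belowP => y z _.
rewrite /run => -[b' fb' ->] bb'.
by apply: free_belowW fb'.
Qed.

Lemma run_leq e n (pi : 'S_n) : (run e pi <= n)%N.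
Proof. by apply/bigmax_leqP => b _; rewrite -ltnS. Qed.

Lemma runE e n r (pi : 'S_n) : (r <= n)%N ->
  (forall b, (b <= n)%N -> free_below e b pi = (b <= r)%N) -> run e pi = r.
Proof.
move=> rn H; apply/eqP; rewrite eqn_leq -H ?run_leq//.
by rewrite free_below_run ?run_leq// leqnn -free_below_run// H ?leqnn.
Qed.

(** The run of the avoider obtained by putting a in front of an avoider of run s.
For 312 the values 0, ..., a are now in decreasing order while a + 1 comes after
a. For 321 a new value 0 prolongs the increasing run, whereas a > 0 precedes 0. *)
Definition front_run e a s : nat := if e then a.+1 else if a == 0 then s.+1 else a.

Lemma run_front e n (a : 'I_n.+1) (pi : 'S_n) : free_below e a pi ->
  run e (lift_perm ord0 a pi) = front_run e a (run e pi).
Proof.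
move=> fa; apply: runE => [|b bn].
  rewrite /front_run; case: e {fa} => //; case: eqP => _; first by rewrite ltnS run_leq.
  exact: ltnW.
(* Pairs of positions behind the new first value, and pairs that contain it. *)
have key : reflect ((forall y z : 'I_n, (y < z)%N -> (bump a (pi y) < b)%N ->
    (bump a (pi z) < b)%N -> (pi y < pi z)%N != e) /\
    ((a < b)%N -> forall z : 'I_n, (bump a (pi z) < b)%N -> (a < bump a (pi z))%N != e))
    (free_below e b (lift_perm ord0 a pi)).
  apply: (iffP (free_belowP _ _ _)) => [H|[H1 H2] y z].
    split=> [y z yz yb zb|ab z zb].
      have := H (lift ord0 y) (lift ord0 z).
      by rewrite !lift_perm_lift /= !lt_bump; apply.
    have := H ord0 (lift ord0 z).
    by rewrite lift_perm_id !lift_perm_lift /=; apply.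
  case: (unliftP ord0 z) => [z'|] -> //.
  case: (unliftP ord0 y) => [y'|] ->.
    by rewrite !lift_perm_lift /= !lt_bump; exact: H1.
  by rewrite lift_perm_id !lift_perm_lift /= => _ ab; exact: H2.
(* A value that refutes a longer run is attained behind a: the old a (now a + 1)
   for 312, and 0 for 321 with a > 0. *)
have surj v : (v < n)%N -> exists z, pi z = v :> nat.
  by move=> vn; exists ((pi^-1)%g (Ordinal vn)); rewrite permKV.
move/free_belowP : (fa) => fa'.
apply/key/idP => [[H1 H2]|].
  rewrite leqNgt; apply/negP; rewrite /front_run; case: e fa fa' H1 H2 {key} => fa fa' H1 H2.
    move=> ab; have [|z za] := surj a; first by lia.
    by have := H2 _ z; rewrite /bump za leqnn; lia.
  case: eqP => [a0|/eqP a0] rb.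
    have : free_below false b.-1 pi.
      apply/free_belowP => y z yz yb zb; apply: H1 => //; rewrite /bump; lia.
    by rewrite free_below_run; lia.
  have [|z za] := surj 0%N; first by have := ltn_ord a; lia.
  have := H2 _ z; rewrite /bump za; lia.
rewrite /front_run => br; split=> [y z yz yb zb|ab z].
  case: e fa fa' br {key} => fa fa' br.
    by apply: fa' => //; move: yb zb; rewrite /bump; lia.
  move: br; case: eqP => [a0|/eqP a0] br.
    have : free_below false b.-1 pi by rewrite free_below_run; lia.
    by move=> /free_belowP; apply=> //; move: yb zb; rewrite /bump a0; lia.
  by apply: fa' => //; move: yb zb; rewrite /bump; lia.
case: e fa fa' br {key} => fa fa'; first by rewrite /bump; lia.
case: eqP => [a0|/eqP a0] br; last by lia.
by rewrite /bump a0 leq0n.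
Qed.

Lemma front_bij n : bijective (fun p : 'S_n * 'I_n.+1 => lift_perm ord0 p.2 p.1).
Proof.
apply: inj_card_bij => [[s a] [t b] /= st|]; last first.
  by rewrite card_prod !card_Sn card_ord factS mulnC.
have ab : a = b.
  by have := congr1 (fun p : 'S_n.+1 => p ord0) st; rewrite /= !lift_perm_id.
rewrite ab in st *; congr (_, _); apply/permP => i.
have := congr1 (fun p : 'S_n.+1 => p (lift ord0 i)) st.
by rewrite /= !lift_perm_lift; exact: lift_inj.
Qed.

(** Sequences of values make it possible to speak of the first values of
permutations of varying size. *)
Definition vals n (pi : 'S_n) : seq nat := [seq nat_of_ord (pi i) | i <- enum 'I_n].

Lemma size_vals n (pi : 'S_n) : size (vals pi) = n.
Proof. by rewrite size_map size_enum_ord. Qed.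

Lemma vals_front n (a : 'I_n.+1) (pi : 'S_n) :
  vals (lift_perm ord0 a pi) = (a : nat) :: map (bump a) (vals pi).
Proof.
rewrite /vals enum_ordSl /= lift_perm_id; congr cons; rewrite -!map_comp.
by apply: eq_map => i /=; rewrite lift_perm_lift.
Qed.

Variable R : realType.

Definition avsum e n (Phi : seq nat -> nat -> R) : R :=
  \sum_(pi in Av3 e n) Phi (vals pi) (run e pi).

Lemma eq_avsum e n (Phi Psi : seq nat -> nat -> R) :
  (forall l s, size l = n -> Phi l s = Psi l s) -> avsum e n Phi = avsum e n Psi.
Proof. by move=> H; apply: eq_bigr => pi _; rewrite H ?size_vals. Qed.

Lemma avsum0 e (Phi : seq nat -> nat -> R) : avsum e 0 Phi = Phi [::] 0.
Proof.
have one (pi : 'S_0) : pi = 1%g by apply/permP => -[].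
rewrite /avsum (big_pred1 1%g) => [|pi].
  have := run_leq e (1%g : 'S_0); rewrite leqn0 => /eqP ->.
  by rewrite (size0nil (size_vals _)).
by rewrite (one pi) /= eqxx; apply/Av3P => -[].
Qed.

(** The generating tree, in the only form used below: a sum over the avoiders of
size n + 1 is a sum over those of size n of the sum over their children. *)
Lemma avsumS e n (Phi : seq nat -> nat -> R) :
  avsum e n.+1 Phi = avsum e n (fun l s =>
    \sum_(a < s.+1) Phi ((a : nat) :: map (bump a) l) (front_run e a s)).
Proof.
rewrite /avsum (reindex _ (onW_bij _ (front_bij n))) /=.
under [RHS]eq_bigr => pi _.
  have rn : ((run e pi).+1 <= n.+1)%N by rewrite ltnS run_leq.
  rewrite (big_ord_widen _ (fun a => Phi (a :: map (bump a) (vals pi))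
    (front_run e a (run e pi))) rn).
  over.
rewrite pair_big_dep /=; apply: eq_big => -[pi a] /=.
  by rewrite Av3_front free_below_run ?ltnS// -ltnS.
rewrite Av3_front => /andP[_ fa].
by rewrite vals_front run_front.
Qed.

(** For both patterns [front_run e] permutes the runs 1, ..., s + 1, which is why
312 and 321 have the same enumeration. *)
Lemma sum_front_run e (w : nat -> R) s :
  \sum_(a < s.+1) w (front_run e a s) = children_sum w s.
Proof.
rewrite /children_sum /front_run; case: e => //.
by rewrite big_ord_recl /= addrC [RHS]big_ord_recr.
Qed.

Lemma avsum_run e n (w : nat -> R) : avsum e n (fun=> w) = descendants n w 0.
Proof.
elim: n w => [|n IH] w; first exact: avsum0.
rewrite avsumS descendantsSr -IH; apply: eq_avsum => l s _.
exact: sum_front_run.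
Qed.

End FrontInsertion.

(** * Proportions of avoiders with prescribed values *)

Section Corners.
Variable R : realType.

Lemma ratio_cvg_shift N (u : nat -> R) :
  ratio_cvg (fun n => u (N + n)%N) -> ratio_cvg u.
Proof.
elim: N => //= N IH cu; apply: IH; apply/ratio_cvgS.
by apply: (ratio_cvg_eventually (N := 0)) cu => n _; rewrite addnS.
Qed.

Lemma ratio_cvg_bounded (u : nat -> R) : ratio_cvg u ->
  exists M, forall n, `|u n| <= M * catalan R n.
Proof.
move=> /cvg_seq_bounded [M [Mr /(_ (M + 1))]]; rewrite ltrDl ltr01 => /(_ isT) uM.
exists (M + 1) => n; have /= := uM n I.
by rewrite normrM normfV (gtr0_norm (catalan_gt0 R n)) ler_pdivrMr ?catalan_gt0.
Qed.

(** Induction on p: summing over the children removes one of the first values and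
multiplies the growth by at most a factor linear in the run. When no value is left,
only a weight of polynomial growth in the run remains. *)
Lemma avsum_take_cvg e p d (M : R) (F : seq nat -> nat -> R) :
  (forall l s, `|F l s| <= M * (1 + s + sumn l)%:R ^+ d) ->
  ratio_cvg (fun n => avsum e n (fun l s => F (take p l) s)).
Proof.
elim: p d M F => [|p IH] d M F FM.
  apply: (ratio_cvg_eventually (N := 0) (u := fun n => descendants n (F [::]) 0)).
    by move=> n _; rewrite -(avsum_run e); apply: eq_avsum => l s _; rewrite take0.
  apply: ratio_cvg_root; exists M, d => s.
  by have := FM [::] s; rewrite /= addn0 add1n.
have M0 : 0 <= M.
  by have := FM [::] 0%N; rewrite expr1n mulr1; apply: le_trans.
apply/ratio_cvgS.
pose G l s := \sum_(a < s.+1) F ((a : nat) :: map (bump a) (take p l)) (front_run e a s).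
have GM l s : `|G l s| <= M * p.+2%:R ^+ d * (1 + s + sumn l)%:R ^+ d.+1.
  apply: le_trans (ler_norm_sum _ _ _) _.
  have term (a : 'I_s.+1) : `|F ((a : nat) :: map (bump a) (take p l)) (front_run e a s)| <=
      M * p.+2%:R ^+ d * (1 + s + sumn l)%:R ^+ d.
    apply: le_trans (FM _ _) _; rewrite -mulrA ler_wpM2l// -exprMn -natrM.
    rewrite lerXn2r ?nnegrE// ler_nat.
    have sum_bump (t : seq nat) : (sumn (map (bump a) t) <= sumn t + size t)%N.
      by elim: t => //= x t; rewrite /bump; lia.
    have := sum_bump (take p l); have : (size (take p l) <= p)%N.
      by rewrite size_take; case: ltnP; lia.
    have : (sumn (take p l) <= sumn l)%N.
      by rewrite -[X in (_ <= sumn X)%N](cat_take_drop p) sumn_cat leq_addr.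
    have : (front_run e a s <= s.+1)%N.
      by rewrite /front_run; have := ltn_ord a; case: (e) => //; case: eqP; lia.
    have := ltn_ord a; rewrite /= ; nia.
  apply: (le_trans (ler_sum _ (fun a _ => term a))).
  rewrite sumr_const card_ord -[leLHS]mulr_natr -[leLHS]mulrA ler_wpM2l ?mulr_ge0 ?exprn_ge0//.
  rewrite [leRHS]exprSr ler_wpM2l ?exprn_ge0// ler_nat; lia.
apply: (ratio_cvg_eventually (N := 0)) (IH _ _ _ GM) => n _.
rewrite avsumS; apply: eq_avsum => l s _; apply: eq_bigr => a _ /=.
by rewrite take_takel// map_take.
Qed.

Definition matches (m : seq (nat * nat)) (l : seq nat) : bool :=
  all (fun q => onth l q.1 == Some q.2) m.

Lemma fst_lt_max (m : seq (nat * nat)) q :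
  q \in m -> (q.1 < (\max_(q <- m) q.1).+1)%N.
Proof. by move=> qm; rewrite ltnS; exact: (leq_bigmax_seq _ qm). Qed.

Lemma onth_take (l : seq nat) p i : (i < p)%N -> onth (take p l) i = onth l i.
Proof. by move=> ip; rewrite !onthE map_take nth_take. Qed.

Lemma avsum_matches_cvg e m :
  ratio_cvg (fun n => avsum e n (fun l _ => (matches m l)%:R : R)).
Proof.
have bound l (s : nat) : `|(matches m l)%:R| <= 1 * (1 + s + sumn l)%:R ^+ 0 :> R.
  by rewrite expr0 mulr1 normr_nat lern1; case: matches.
have cm := avsum_take_cvg (e := e) (p := (\max_(q <- m) q.1).+1) bound.
apply: (ratio_cvg_eventually (N := 0)) cm => n _.
apply: eq_avsum => l s _; congr (_%:R); congr nat_of_bool.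
by apply: eq_in_all => q qm; rewrite onth_take// fst_lt_max.
Qed.

(** A value q.2 at position q.1 of the complement is the value n - 1 - q.2 of the
avoider itself. By Markov's inequality the proportion of such avoiders is
O(1 / n), as the sum of the values at position q.1 is O(catalan n). *)
Lemma avsum_complement_cvg e q m :
  ratio_cvg (fun n => avsum e n (fun l _ =>
    (matches (q :: m) (map (fun v => n - v.+1)%N l))%:R : R)).
Proof.
set u := fun n => _; apply: ratio_cvg_approx => eps eps0.
have nth_le l (s : nat) : `|(nth 0%N l q.1)%:R| <= 1 * (1 + s + sumn l)%:R ^+ 1 :> R.
  rewrite expr1 mul1r normr_nat ler_nat.
  have : (nth 0%N l q.1 <= sumn l)%N.
    elim: l q.1 => [|x l IH] [|i] //=; first exact: leq_addr.
    by rewrite (leq_trans (IH i))// leq_addl.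
  lia.
have [B cB] := ratio_cvg_bounded (avsum_take_cvg (e := e) (p := q.1.+1) nth_le).
have B0 : 0 <= B.
  by rewrite -(pmulr_lge0 _ (catalan_gt0 R 0)) (le_trans _ (cB 0%N)).
have [N NB] : exists N, B <= eps * N.+1%:R.
  exists (Num.truncn (B / eps)); rewrite mulrC -ler_pdivrMr//.
  by apply: ltW; exact: truncnS_gt.
exists (fun n => if (n < N.+1 + q.2.+1)%N then u n else 0).
  have c0 := @ratio_cvg0 R; apply: (ratio_cvg_eventually (N := (N.+1 + q.2.+1)%N)) c0 => n Nn.
  by rewrite ltnNge Nn.
move=> n; case: ltnP => [_|Nn].
  by rewrite subrr normr0 mulr_ge0// ltW ?catalan_gt0.
rewrite subr0 ger0_norm; last by apply: sumr_ge0 => pi _; rewrite ler0n.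
have : N.+1%:R * u n <= B * catalan R n.
  apply: le_trans (le_trans (ler_norm _) (cB n)).
  rewrite /u /avsum mulr_sumr; apply: ler_sum => pi _.
  rewrite -natrM ler_nat; case: (boolP (matches _ _)) => [|_]; last by rewrite muln0.
  rewrite /= => /andP[/eqP + _]; rewrite onth_map muln1 nth_take//.
  by case E: (onth _ _) => [v|] //= [vq]; rewrite (@onth_nth _ 0%N _ _ _ E); lia.
move=> H; rewrite -(ler_pM2l (_ : 0 < N.+1%:R))// (le_trans H)//.
by rewrite mulrA ler_wpM2r ?(ltW (catalan_gt0 _ _))// mulrC.
Qed.

Lemma onth_rev_cons (a : nat) (l : seq nat) i : (i < size l)%N ->
  onth (rev (a :: l)) i = onth (rev l) i.
Proof.
by move=> il; rewrite rev_cons !onthE map_rcons nth_rcons size_map size_rev il.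
Qed.

(** The sum over the children obtained by inserting a value larger than v. *)
Definition above v (w : nat -> R) : nat -> R :=
  fun s => \sum_(a < s.+1 | (v < a)%N) w a.+1.

Lemma above_shift v w s :
  above v w (s + v.+1)%N = children_sum (fun t => w (t + v.+1)%N) s.
Proof.
rewrite /above /children_sum big_mkcond -addSn addnC big_split_ord /=.
rewrite big1 ?add0r => [|a _]; last by rewrite ltnNge -ltnS ltn_ord.
apply: eq_bigr => j _; rewrite leq_addr; congr w; lia.
Qed.

Lemma above_eq0 v w s : (s <= v)%N -> above v w s = 0.
Proof.
move=> sv; rewrite /above big1// => a va; have := ltn_ord a; lia.
Qed.

(** Counting runs from v + 1 turns insertion above v into the Catalan operator. *)
Lemma iter_above_shift k v w s :
  iter k (above v) w (s + v.+1)%N = descendants k (fun t => w (t + v.+1)%N) s.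
Proof.
elim: k s => //= k IH s; rewrite above_shift; congr (children_sum _ s).
by apply/funext => t; rewrite IH.
Qed.

Definition delete_value a (m : seq (nat * nat)) : seq (nat * nat) :=
  [seq (q.1, unbump a q.2) | q <- m].

(** Seen from the end, positions do not move when a value is put in front: only
the values above a are shifted. *)
Lemma matches_rev_front n (m : seq (nat * nat)) (a : nat) (l : seq nat) :
  all (fun q => q.1 < n)%N m -> size l = n ->
  matches m (rev (a :: map (bump a) l)) =
  all (fun q => q.2 != a) m && matches (delete_value a m) (rev l).
Proof.
move=> mn ln; rewrite /matches /delete_value all_map -all_predI.
apply: eq_in_all => q qm /=; have /allP/(_ _ qm) qn := mn.
rewrite onth_rev_cons ?size_map ?ln// -map_rev onth_map.
case: (onth (rev l) q.1) => [x|] /=; last by rewrite andbF.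
apply/eqP/andP => [[<-]|[qa /eqP[->]]].
  by rewrite bumpK eqxx eq_sym neq_bump.
by rewrite unbumpKcond (negPf qa).
Qed.

Lemma sum_below (s v : nat) (H : nat -> R) :
  \sum_(a < s.+1 | (a < v)%N) H a = \sum_(a < v) (a <= s)%N%:R * H a.
Proof.
have [vs|sv] := leqP v s.+1.
  rewrite -(big_ord_widen _ H vs); apply: eq_bigr => a _.
  by rewrite (_ : (a <= s)%N = true) ?mul1r//; have := ltn_ord a; lia.
rewrite (eq_bigl xpredT) => [|a]; last by have := ltn_ord a; lia.
rewrite (big_ord_widen _ H (ltnW sv)) big_mkcond; apply: eq_bigr => a _.
by rewrite ltnS; case: leqP => _; rewrite ?mul1r ?mul0r.
Qed.

Lemma poly_bounded_shift (w : nat -> R) v : poly_bounded w ->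
  poly_bounded (fun t => w (t + v)%N).
Proof.
move=> [M [d wM]]; exists (M * v.+1%:R ^+ d), d => s.
have M0 : 0 <= M.
  by have := wM 0%N; rewrite expr1n mulr1; apply: le_trans.
apply: le_trans (wM _) _; rewrite -mulrA ler_wpM2l// -exprMn -natrM.
rewrite lerXn2r ?nnegrE// ler_nat; nia.
Qed.

(** Induction on a strict bound v + 1 of the prescribed values, where v may be
assumed to be prescribed. The first value of an avoider is then different from
v. Values below v lead to prescriptions bounded by v, hence to the induction
hypothesis; values above v give the iterates of [above v]. *)
Lemma avsum_rev_matches_cvg v (m : seq (nat * nat)) (w : nat -> R) :
  all (fun q => q.2 < v)%N m -> poly_bounded w ->
  ratio_cvg (fun n => avsum true n (fun l s => (matches m (rev l))%:R * w s)).
Proof.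
elim: v m w => [|v IH] m w mv pw.
  have -> : m = [::] by case: m mv.
  apply: (ratio_cvg_eventually (N := 0)) (ratio_cvg_root pw) => n _.
  by rewrite -(avsum_run true); apply: eq_avsum => l s _; rewrite mul1r.
have [vm|vm] := boolP (has (fun q => q.2 == v) m); last first.
  apply: IH => //; apply/allP => q qm.
  by have /allP/(_ _ qm) := mv; rewrite ltnS leq_eqVlt (negPf (hasPn vm _ qm)).
pose E n (w : nat -> R) := avsum true n (fun l s => (matches m (rev l))%:R * w s).
(* A value that is prescribed elsewhere cannot be put in front. *)
pose good a := all (fun q : nat * nat => q.2 != a) m.
pose D n a := avsum true n
  (fun l s => (matches (delete_value a m) (rev l))%:R * threshold R a s).
pose N := (\max_(q <- m) q.1).+1.
(* The children of an avoider of size n: a < v gives the first sum, where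
   threshold a says that a does not exceed the run; a = v gives nothing. *)
have recE n w' : (N <= n)%N ->
    E n.+1 w' = \sum_(a < v) (good a)%:R * w' a.+1 * D n a + E n (above v w').
  move=> Nn; have mn : all (fun q => q.1 < n)%N m.
    by apply/allP => q qm; exact: leq_trans (fst_lt_max qm) Nn.
  rewrite /E avsumS /D.
  under [X in _ = X + _]eq_bigr do rewrite /avsum mulr_sumr.
  rewrite exchange_big -big_split /=; apply: eq_bigr => pi _.
  set l := vals pi; set s := run true pi.
  rewrite (bigID (fun a : 'I_s.+1 => (a < v)%N)) /=; congr (_ + _).
    rewrite (sum_below s v (fun a => (matches m (rev (a :: map (bump a) l)))%:R * w' a.+1)).
    apply: eq_bigr => a _.
    rewrite (matches_rev_front a mn (size_vals pi)) /good -/l /threshold.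
    by case: all; case: matches; case: (a <= s)%N; rewrite /=; ring.
  rewrite /above mulr_sumr big_mkcond [RHS]big_mkcond; apply: eq_bigr => a _.
  rewrite -leqNgt (matches_rev_front a mn (size_vals pi)) -/l.
  case: ltngtP => // [va|va].
    have -> : all (fun q : nat * nat => q.2 != a) m.
      by apply/allP => q qm; have /allP/(_ _ qm) := mv; lia.
    suff -> : delete_value a m = m by [].
    rewrite /delete_value -[RHS]map_id; apply/eq_in_map => -[i x] qm.
    by have /allP/(_ _ qm) /= := mv; rewrite /unbump => xv; congr pair; lia.
  rewrite (_ : all _ _ = false) ?mul0r//.
  by apply/negbTE; rewrite -has_predC; apply: sub_has vm => q /=; rewrite -va negbK.
(* From size N on, [above v w'] vanishes at the runs a + 1 <= v coming from
   a < v, so E n.+1 (above v w) is E n of the next iterate of [above v]. *)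
have cX : ratio_cvg (fun n => E n (above v w)).
  apply: (@ratio_cvg_shift N).
  have -> : (fun k => E (N + k)%N (above v w)) =
            (fun k => E N (iter k.+1 (above v) w)).
    apply/funext => k; elim: k (w) => [|k IHk] w'; first by rewrite addn0.
    rewrite addnS recE ?leq_addr// big1 ?add0r => [|a _]; last first.
      by rewrite above_eq0 ?mulr0 ?mul0r.
    by rewrite IHk -!iterSr.
  rewrite /E /avsum.
  apply: ratio_cvg_sum => pi _; apply: ratio_cvgZ.
  have [rv|vr] := leqP (run true pi) v.
    have c0 := @ratio_cvg0 R.
    by apply: (ratio_cvg_eventually (N := 0)) c0 => k _; rewrite /= above_eq0.
  have cd := (ratio_cvgS _).2
    (ratio_cvg_descendants (s := (run true pi - v.+1)%N) (poly_bounded_shift v.+1 pw)).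
  apply: (ratio_cvg_eventually (N := 0)) cd => k _.
  by rewrite -iter_above_shift subnK.
apply/ratio_cvgS.
have cD : ratio_cvg (fun n => \sum_(a < v) (good a)%:R * w a.+1 * D n a).
  apply: ratio_cvg_sum => a _; apply: ratio_cvgZ; apply: IH.
    apply/allP => _ /mapP[q qm ->] /=; have /allP/(_ _ qm) := mv.
    by rewrite /unbump; have := ltn_ord a; lia.
  exists 1, 0%N => s; rewrite expr0 mulr1 /threshold normr_nat lern1.
  by case: (a <= s)%N.
apply: (ratio_cvg_eventually (N := N)) (ratio_cvgD cD cX) => n Nn.
by rewrite -recE.
Qed.

End Corners.

(** * Reduction of the six patterns to 312 and 321 *)

Section Symmetries.

Lemma perm_containsP n m (pi : 'S_n) (sigma : 'S_m) :
  reflect (exists i : 'I_m -> 'I_n, forall j k,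
             (i j < i k)%N = (j < k)%N /\ (pi (i j) < pi (i k))%N = (sigma j < sigma k)%N)
          (perm_contains pi sigma).
Proof.
apply: (iffP existsP) => [[i /forallP H]|[i H]]; last first.
  exists (finfun i); apply/forallP => j; apply/forallP => k; apply/implyP => jk.
  by rewrite !ffunE (H j k).1 (H j k).2 jk eqxx.
have {}H (j k : 'I_m) : (j < k)%N ->
    (i j < i k)%N /\ (pi (i j) < pi (i k))%N = (sigma j < sigma k)%N.
  by move=> jk; have /forallP/(_ k) := H j; rewrite jk => /andP[-> /eqP].
have sym p (s : 'S_p) (x y : 'I_p) : x != y -> (s x < s y)%N = ~~ (s y < s x)%N.
  move=> xy; rewrite -leqNgt ltn_neqAle.
  by have -> : s x != s y :> nat by rewrite (inj_eq val_inj) (inj_eq perm_inj).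
exists i => j k; case: (ltngtP j k) => [/H[-> ->]|kj|/val_inj ->]; last by rewrite !ltnn.
  by [].
have [ikj pkj] := H _ _ kj; split; first by apply/negbTE; rewrite -leqNgt ltnW.
rewrite sym 1?(sym _ sigma) ?pkj//; last by rewrite -(inj_eq val_inj) /= gtn_eqF.
by rewrite -(inj_eq val_inj) /= gtn_eqF.
Qed.

(** Right and left multiplication by this permutation are the complement and the
reverse of a permutation. *)
Definition flip n : 'S_n := perm (@rev_ord_inj n).

Lemma flipE n i : flip n i = rev_ord i. Proof. by rewrite permE. Qed.

Lemma flip_lt n (i j : 'I_n) : (flip n i < flip n j)%N = (j < i)%N.
Proof. by rewrite !flipE /=; have := ltn_ord i; have := ltn_ord j; lia. Qed.

Lemma flipK n : (flip n * flip n = 1)%g.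
Proof. by apply/permP => i; rewrite permM !flipE rev_ordK perm1. Qed.

Lemma flip_flip n i : flip n (flip n i) = i.
Proof. by rewrite !flipE rev_ordK. Qed.

Lemma contains_complement n m (pi : 'S_n) (sigma : 'S_m) :
  perm_contains (pi * flip n)%g (sigma * flip m)%g = perm_contains pi sigma.
Proof.
have imp (p : 'S_n) (s : 'S_m) :
    perm_contains p s -> perm_contains (p * flip n)%g (s * flip m)%g.
  move=> /perm_containsP[i H]; apply/perm_containsP; exists i => j k.
  by rewrite !permM !flip_lt (H j k).1 (H k j).2.
apply/idP/idP => /imp //.
by rewrite -!mulgA !flipK !mulg1.
Qed.

Lemma contains_reverse n m (pi : 'S_n) (sigma : 'S_m) :
  perm_contains (flip n * pi)%g (flip m * sigma)%g = perm_contains pi sigma.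
Proof.
have imp (p : 'S_n) (s : 'S_m) :
    perm_contains p s -> perm_contains (flip n * p)%g (flip m * s)%g.
  move=> /perm_containsP[i H]; apply/perm_containsP.
  exists (fun j => flip n (i (flip m j))) => j k.
  by rewrite !permM !flip_lt !flip_flip (H _ _).1 (H _ _).2 flip_lt.
apply/idP/idP => /imp //.
by rewrite !mulgA !flipK !mul1g.
Qed.

Lemma contains_inverse n m (pi : 'S_n) (sigma : 'S_m) :
  perm_contains pi^-1%g sigma^-1%g = perm_contains pi sigma.
Proof.
have imp n' m' (p : 'S_n') (s : 'S_m') :
    perm_contains p s -> perm_contains p^-1%g s^-1%g.
  move=> /perm_containsP[i H]; apply/perm_containsP.
  exists (fun j => p (i ((s^-1)%g j))) => j k.
  by rewrite (H _ _).2 !permKV !permK (H _ _).1.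
by apply/idP/idP => /imp //; rewrite !invgK.
Qed.

Definition o0 : 'I_3 := ord0.
Definition o1 : 'I_3 := Ordinal (isT : (1 < 3)%N).
Definition o2 : 'I_3 := Ordinal (isT : (2 < 3)%N).

Lemma ord3P (j : 'I_3) : [\/ j = o0, j = o1 | j = o2].
Proof.
by case: j => [[|[|[|//]]] j3]; [constructor 1|constructor 2|constructor 3]; apply: val_inj.
Qed.

(** Sigma begins with its maximum, hence is 312 or 321. *)
Lemma Av_max_first n (sigma : 'S_3) : sigma o0 = o2 ->
  Av n sigma = Av3 (sigma o1 < sigma o2)%N n.
Proof.
move=> s0.
have lt2 j : j != o0 -> (sigma j < 2)%N.
  rewrite -(inj_eq (@perm_inj _ sigma)) s0 -(inj_eq val_inj) /=.
  by have := ltn_ord (sigma j); lia.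
have lt20 j : j != o0 -> (2 < sigma j)%N = false.
  by move=> /lt2; lia.
apply/setP => pi; rewrite inE; apply/idP/Av3P => [/negP nc x y z xy yz yx zx|H].
  apply/eqP => pe; apply: nc; apply/existsP.
  (* The occurrence x < y < z seen as a function on the positions of sigma. *)
  exists [ffun j : 'I_3 => if j == o0 then x else if j == o1 then y else z].
  apply/forallP => j; apply/forallP => k; apply/implyP.
  case: (ord3P j) => ->; case: (ord3P k) => -> //= _; rewrite !ffunE /= ?s0 /=.
  - by rewrite xy lt20// ltnNge ltnW.
  - by rewrite (ltn_trans xy yz) lt20// ltnNge ltnW.
  - by rewrite yz pe eqxx.
apply/perm_containsP => -[i E].
have := H (i o0) (i o1) (i o2); rewrite !(E _ _).1 !(E _ _).2 /= s0 !lt2// eqxx.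
by move=> /(_ isT isT isT isT).
Qed.

Variable R : realType.

Lemma sum_Av_complement n (sigma : 'S_3) (F : 'S_n -> R) :
  \sum_(pi in Av n sigma) F pi =
  \sum_(pi in Av n (sigma * flip 3)%g) F (pi * flip n)%g.
Proof.
rewrite (reindex_inj (mulIg (flip n))) /=; apply: eq_bigl => pi.
by rewrite !inE -contains_complement -mulgA flipK mulg1.
Qed.

Lemma sum_Av_reverse n (sigma : 'S_3) (F : 'S_n -> R) :
  \sum_(pi in Av n sigma) F pi =
  \sum_(pi in Av n (flip 3 * sigma)%g) F (flip n * pi)%g.
Proof.
rewrite (reindex_inj (mulgI (flip n))) /=; apply: eq_bigl => pi.
by rewrite !inE -contains_reverse mulgA flipK mul1g.
Qed.

Lemma sum_Av_inverse n (sigma : 'S_3) (F : 'S_n -> R) :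
  \sum_(pi in Av n sigma) F pi = \sum_(pi in Av n sigma^-1%g) F pi^-1%g.
Proof.
rewrite (reindex_inj invg_inj) /=; apply: eq_bigl => pi.
by rewrite !inE -contains_inverse invgK.
Qed.

(** Patterns beginning with 3 are direct; those beginning with 1 are complements
of these; 213 is the reverse of 312; 231 is its inverse. *)
Lemma sum_Av_cases (sigma : 'S_3) : exists e,
  [\/ forall n (F : 'S_n -> R),
        \sum_(pi in Av n sigma) F pi = \sum_(pi in Av3 e n) F pi,
      forall n (F : 'S_n -> R),
        \sum_(pi in Av n sigma) F pi = \sum_(pi in Av3 e n) F (pi * flip n)%g,
      e /\ forall n (F : 'S_n -> R),
        \sum_(pi in Av n sigma) F pi = \sum_(pi in Av3 e n) F (flip n * pi)%g |
      forall n (F : 'S_n -> R),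
        \sum_(pi in Av n sigma) F pi = \sum_(pi in Av3 e n) F pi^-1%g].
Proof.
case: (ord3P (sigma o0)) => s0.
- exists ((sigma * flip 3)%g o1 < (sigma * flip 3)%g o2)%N; constructor 2 => n F.
  rewrite sum_Av_complement Av_max_first// (permM sigma (flip 3) o0) s0 flipE; exact: val_inj.
- case: (ord3P (sigma o1)) => s1.
  + have s2 : sigma o2 = o2.
      case: (ord3P (sigma o2)) => // s2; first by have := perm_inj (etrans s2 (esym s1)).
      by have := perm_inj (etrans s2 (esym s0)).
    have f0 : flip 3 o0 = o2 by rewrite flipE; exact: val_inj.
    have f1 : flip 3 o1 = o1 by rewrite flipE; exact: val_inj.
    have f2 : flip 3 o2 = o0 by rewrite flipE; exact: val_inj.
    exists true; constructor 3; split=> // n F.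
    have fs j : (flip 3 * sigma)%g j = sigma (flip 3 j) by exact: permM.
    by rewrite sum_Av_reverse Av_max_first ?fs ?f0// f1 f2 s0 s1.
  + by have := perm_inj (etrans s0 (esym s1)).
  + have s2 : sigma o2 = o0.
      case: (ord3P (sigma o2)) => // s2; first by have := perm_inj (etrans s2 (esym s0)).
      by have := perm_inj (etrans s2 (esym s1)).
    exists ((sigma^-1)%g o1 < (sigma^-1)%g o2)%N; constructor 4 => n F.
    by rewrite sum_Av_inverse Av_max_first// -s2 permK.
- by exists (sigma o1 < sigma o2)%N; constructor 1 => n F; rewrite Av_max_first.
Qed.

Lemma onth_valsP n (pi : 'S_n) i a :
  reflect (exists j : 'I_n, j = i :> nat /\ pi j = a :> nat) (onth (vals pi) i == Some a).
Proof.
have sz := size_vals pi; have [ni|ni] := leqP n i.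
  rewrite onth_default ?sz//; right => -[j [ji _]]; have := ltn_ord j; lia.
have -> : onth (vals pi) i = Some (pi (Ordinal ni) : nat).
  rewrite onthE (nth_map 0%N) ?sz// /vals (nth_map (Ordinal ni)) ?size_enum_ord//.
  by congr (Some (nat_of_ord (pi _))); apply: val_inj; rewrite /= nth_enum_ord.
apply: (iffP eqP) => [[<-]|[j [ji <-]]]; first by exists (Ordinal ni).
by congr (Some (nat_of_ord (pi _))); apply: val_inj.
Qed.

Lemma vals_complement n (pi : 'S_n) :
  vals (pi * flip n)%g = map (fun v => n - v.+1)%N (vals pi).
Proof. by rewrite /vals -map_comp; apply: eq_map => i /=; rewrite permM flipE. Qed.

Lemma onth_rev (l : seq nat) i : (i < size l)%N ->
  onth (rev l) i = onth l (size l - i.+1)%N.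
Proof. by move=> il; rewrite !onthE map_rev nth_rev size_map. Qed.

Lemma vals_reverse n (pi : 'S_n) : vals (flip n * pi)%g = rev (vals pi).
Proof.
apply: eq_from_onth => i; have [ni|ni] := leqP n i.
  by rewrite !onth_default ?size_rev ?size_vals.
have -> : onth (vals (flip n * pi)%g) i = Some (pi (flip n (Ordinal ni)) : nat).
  by apply/eqP/onth_valsP; exists (Ordinal ni); rewrite permM.
rewrite onth_rev size_vals//; symmetry.
apply/eqP/onth_valsP; exists (flip n (Ordinal ni)); split=> //.
by rewrite flipE.
Qed.

Lemma matches_inverse n (pi : 'S_n) m :
  matches m (vals pi^-1%g) = matches [seq (q.2, q.1) | q <- m] (vals pi).
Proof.
rewrite /matches all_map; apply: eq_all => q /=.
apply/onth_valsP/onth_valsP => -[j [ji ja]].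
  by exists ((pi^-1)%g j); rewrite permKV.
by exists (pi j); rewrite permK.
Qed.

Lemma card_Av (sigma : 'S_3) n : #|Av n sigma|%:R = catalan R n.
Proof.
rewrite -sum1_card natr_sum.
have main e : \sum_(pi in Av3 e n) (1 : R) = catalan R n.
  exact: (avsum_run e n (fun=> 1)).
by have [e [H|H|[_ H]|H]] := sum_Av_cases sigma; rewrite H.
Qed.

(** The symmetry that turns sigma into 312 or 321 moves the corner of first
positions and small values to one of three corners: first positions, last
positions, or large values; each has its own convergence lemma. *)
Lemma Av_matches_cvg (sigma : 'S_3) m :
  cvgn (fun n => (\sum_(pi in Av n sigma) (matches m (vals pi))%:R) / #|Av n sigma|%:R : R).
Proof.
under eq_fun do rewrite card_Av.
rewrite -/(ratio_cvg _).
have [e [H|H|[e1 H]|H]] := sum_Av_cases sigma.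
- have c := @avsum_matches_cvg R e m.
  by apply: (ratio_cvg_eventually (N := 0)) c => n _; rewrite H.
- case: m => [|q m].
    have c := @avsum_matches_cvg R e [::].
    apply: (ratio_cvg_eventually (N := 0)) c => n _.
    by rewrite H.
  have c := @avsum_complement_cvg R e q m.
  apply: (ratio_cvg_eventually (N := 0)) c => n _.
  by rewrite H; apply: eq_bigr => pi _; rewrite vals_complement.
- have mv : all (fun q => q.2 < (\max_(q <- m) q.2).+1)%N m.
    by apply/allP => q qm; rewrite ltnS; exact: (leq_bigmax_seq _ qm).
  have p1 : poly_bounded (fun=> 1 : R).
    by exists 1, 0%N => s; rewrite expr0 mulr1 normr1.
  apply: (ratio_cvg_eventually (N := 0)) (avsum_rev_matches_cvg mv p1) => n _.
  rewrite H; case: e e1 {H} => // _.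
  by apply: eq_bigr => pi _; rewrite vals_reverse mulr1.
- have c := @avsum_matches_cvg R e [seq (q.2, q.1) | q <- m].
  apply: (ratio_cvg_eventually (N := 0)) c => n _.
  by rewrite H; apply: eq_bigr => pi _; rewrite matches_inverse.
Qed.

End Symmetries.

(** * Binary codes of points of the function space *)

Section Codes.

(** An enumeration of all pairs (i, a); pairs may be repeated, which is harmless. *)
Definition cell (j : nat) : nat * nat := odflt (0, 0)%N (unpickle j).

Lemma cellK q : cell (pickle q) = q.
Proof. by rewrite /cell pickleK. Qed.

Definition hits (q : nat * nat) (x : FNN) : bool := x q.1 == Some q.2.

(** Binary digits of a point; the value infinity is visible only as the absence of
hits. *)
Definition code N (x : FNN) : seq bool := mkseq (fun j => hits (cell j) x) N.

Lemma size_code N x : size (code N x) = N.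
Proof. exact: size_mkseq. Qed.

Lemma codeS N x : code N.+1 x = rcons (code N x) (hits (cell N) x).
Proof. exact: mkseqS. Qed.

Lemma eq_codeP N (x y : FNN) :
  (forall j, (j < N)%N -> hits (cell j) x = hits (cell j) y) <-> code N x = code N y.
Proof.
split=> [H|H j jN].
  by apply/(@eq_from_nth _ false); rewrite !size_code// => j jN; rewrite !nth_mkseq ?H.
by have := congr1 (fun s => nth false s j) H; rewrite !nth_mkseq.
Qed.

Lemma eq_codeW N M (x y : FNN) : (N <= M)%N -> code M x = code M y -> code N x = code N y.
Proof. by move=> NM /eq_codeP H; apply/eq_codeP => j jN; apply: H; exact: leq_trans NM. Qed.

(** Finite points of the compactification are isolated, so hitting one is a clopen
condition. *)
Lemma nbhs_hits q (x : FNN) : nbhs x [set y : FNN | hits q y = hits q x].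
Proof.
have : nbhs (x q.1 : Nstar) [set z : Nstar | (z == Some q.2) = hits q x].
  rewrite /hits; case: (x q.1) => [n|].
    have n1 := one_point_compactification_some_nbhs _ _ (discrete_set1 n).
    by apply: (filterS _ n1) => _ [_ -> <-].
  exists [set q.2]; first by split; [exact: compact_set1|exact: discrete_closed].
  by move=> _ [[n /= nq <-]|->] //=; apply/eqP => -[].
exact: (@proj_continuous nat (fun=> Nstar) q.1 x).
Qed.

Lemma nbhs_code N (x : FNN) : nbhs x [set y : FNN | code N y = code N x].
Proof.
elim: N => [|N IH]; first by apply: filterS (filterT : nbhs x setT) => y _.
apply: filterS (filterI IH (nbhs_hits (cell N) x)) => y [/= yN yx].
by rewrite !codeS yN yx.
Qed.

(** The sets of points with a given finite code form a base. At a coordinate with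
value infinity, a neighbourhood misses only a compact, hence bounded, set of
integers, and finitely many digits suffice to exclude these. *)
Lemma code_nbhs (x : FNN) (U : set FNN) : nbhs x U ->
  exists N, [set y : FNN | code N y = code N x] `<=` U.
Proof.
(* The filter generated by the sets of points with the same codes as x; it is
   enough that it converges to x coordinatewise. *)
pose G := filter_from setT (fun N => [set y : FNN | code N y = code N x]).
have FG : Filter G.
  apply: filter_from_filter; first by exists 0%N.
  move=> N M _ _; exists (maxn N M) => // y /= yx.
  by split; [apply: eq_codeW yx; exact: leq_maxl|apply: eq_codeW yx; exact: leq_maxr].
suff Gx : G --> x by move=> /Gx[N _ NU]; exists N.
apply/cvg_sup => i U' [_ [[W oW <-] Wx] WU'].
have nW : nbhs (x i : Nstar) W by apply: open_nbhs_nbhs.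
apply: (filterS WU'); rewrite nbhs_simpl /=.
case E : (x i) nW => [n|].
  move=> /nbhs_singleton Wn; exists (pickle (i, n)).+1 => // y /eq_codeP /(_ _ (ltnSn _)).
  by rewrite cellK /hits /= E eqxx => /eqP ->.
move=> [K [cK _] KW].
have [B _ KB] : \forall N \near \oo, K `<=` (fun k => k < N)%N.
  move/compact_near_coveringP : cK; apply => k _.
  exists ([set k], [set N | k < N]%N); first by split; [exact: discrete_set1|exists k.+1].
  by move=> [k' N] /= [-> ].
exists (\max_(k < B) (pickle (i, k : nat))).+1 => // y /eq_codeP yx.
apply: KW; case Ey : (y i) => [k|]; last by right.
left; exists k => // Kk; have kB := KB _ (leqnn B) _ Kk.
have := yx (pickle (i, k)); rewrite cellK /hits /= Ey E eqxx => yx'.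
suff : true = false by [].
by apply: yx'; rewrite ltnS; exact: (leq_bigmax (Ordinal kB)).
Qed.

(** Every open set is a countable union of sets determined by finite codes; this
reduces Borel measurability to codes. *)
Lemma open_bigcup_code (U : set FNN) : open U ->
  U = \bigcup_N [set x | (exists2 y : FNN, code N y = code N x &
                   [set z | code N z = code N y] `<=` U)].
Proof.
move=> oU; apply/seteqP; split => [x Ux|x [N _ [y yx yU]]]; last exact: yU.
have [N NU] := code_nbhs (open_nbhs_nbhs (conj oU Ux)).
by exists N => //; exists x.
Qed.

Lemma compact_FNN : compact [set: FNN].
Proof.
have := @tychonoff nat (fun=> Nstar) (fun=> setT)
  (fun=> one_point_compactification_compact).
by congr compact; apply/seteqP; split.
Qed.

(** Uniform continuity on the compact space, with codes instead of a metric. *)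
Lemma uniform_code (R : realType) (f : FNN -> R) (e : R) : continuous f -> 0 < e ->
  exists N, forall x y : FNN, code N x = code N y -> `|f x - f y| <= e.
Proof.
move=> cf e0.
have [N _ H] : \forall N \near \oo,
    [set: FNN] `<=` (fun x => forall y : FNN, code N y = code N x -> `|f x - f y| <= e).
  move/compact_near_coveringP : compact_FNN; apply => x _.
  have e2 : 0 < e / 2 by rewrite divr_gt0.
  have /cvgrPdist_lt/(_ _ e2) : f @ x --> f x by exact: cf.
  move=> /code_nbhs[N NU].
  exists ([set y : FNN | code N y = code N x], [set M | N <= M]%N).
    by split; [exact: nbhs_code|exists N].
  move=> [x' M] /= [x'x NM] y yx'.
  rewrite (splitr e) -(subrKA (f x)) (le_trans (ler_normD _ _))//.
  apply: lerD; apply: ltW; first by rewrite distrC; apply: NU.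
  by apply: NU; rewrite /= -x'x; apply: eq_codeW yx'.
by exists N => x y xy; apply: (H N) => //=.
Qed.

End Codes.

(** * Expectations and finite codes *)

Section CodeExpectation.
Variable R : realType.

Lemma measurable_code N (B : set (seq bool)) :
  measurable ((code N @^-1` B) : set (borel FNN)).
Proof.
apply: sub_sigma_algebra; rewrite /= openE => x /= Bx.
by apply: filterS (nbhs_code N x) => y /= ->.
Qed.

Lemma continuous_borel (f : FNN -> R) : continuous f ->
  measurable_fun [set: borel FNN] (f : borel FNN -> R).
Proof.
move=> /continuousP cf; apply: (measurability _ (RGenOpens.measurableE R)).
move=> _ [_ [a [b ->] <-]]; rewrite setTI; apply: sub_sigma_algebra.
exact/cf/interval_open.
Qed.

Context d (T : measurableType d) (P : probability T R).

Lemma bounded_Lfun (g : T -> R) (M : R) : measurable_fun setT g ->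
  (forall x, `|g x| <= M) -> g \in Lfun P 1.
Proof.
move=> mg gM; apply/Lfun1_integrable; apply: measurable_bounded_integrable => //.
  by apply: le_lt_trans (probability_le1 P measurableT) _; rewrite ltry.
by exists M; split; [exact: num_real|move=> r Mr x _; exact: le_trans (gM x) (ltW Mr)].
Qed.

Lemma expectation_abs_le (g : T -> R) (e : R) : g \in Lfun P 1 ->
  (forall x, `|g x| <= e) -> `|fine 'E_P[g]%E| <= e.
Proof.
move=> gL ge.
have := expectation_fin_num gL; rewrite unlock => fE.
rewrite -lee_fin -fine_abse ?fineK ?abse_fin_num//.
apply: le_trans (le_abse_integral _ _ _) _ => //.
  by move/Lfun1_integrable : gL => /measurable_int.
apply: le_trans (integral_le_bound e%:E _ _ _ _) _ => //=.
- by move/Lfun1_integrable : gL => /measurable_int.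
- by rewrite lee_fin (le_trans _ (ge point)).
- by apply: aeW => x _; rewrite lee_fin.
by rewrite probability_setT mule1.
Qed.

Variable X : {RV P >-> borel FNN}.

Definition law_code (b : seq bool) : R :=
  fine (P (X @^-1` (code (size b) @^-1` [set b]))).

Lemma measurable_RV_code N (B : set (seq bool)) : measurable (X @^-1` (code N @^-1` B)).
Proof.
rewrite -[X in measurable X]setTI.
by apply: (measurable_funP X) => //; exact: measurable_code.
Qed.

Lemma sum_indic_code (h : seq bool -> R) N :
  (fun w => h (code N (X w))) =
  \sum_(g <- [seq (h (tval b) \o* \1_(X @^-1` (code N @^-1` [set tval b])) : T -> R)
             | b : N.-tuple bool]) g.
Proof.
apply/funext => w; rewrite big_map fct_sumE.
have sz : size (code N (X w)) == N by rewrite size_code.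
rewrite big_enum /= (bigD1 (Tuple sz)) //= indicE mem_set//= mul1r.
rewrite big1 ?addr0// => b bn; rewrite indicE memNset ?mul0r// => /= e.
by move/eqP : bn; apply; apply: val_inj.
Qed.

Lemma measurable_fun_code (h : seq bool -> R) N :
  measurable_fun setT (fun w => h (code N (X w))).
Proof.
move=> _ B mB; rewrite setTI.
exact: (measurable_RV_code N (h @^-1` B)).
Qed.

Lemma indic_code_Lfun (b : seq bool) N k :
  (k \o* \1_(X @^-1` (code N @^-1` [set b])) : T -> R) \in Lfun P 1.
Proof.
apply: (@bounded_Lfun _ `|k|).
  apply: measurable_funM; last exact: measurable_cst.
  apply: measurable_indic; exact: measurable_RV_code.
by move=> x; rewrite /= normrM indicE; case: (_ \in _); rewrite ?normr1 ?mul1r ?normr0 ?mul0r.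
Qed.

Lemma expectation_code (h : seq bool -> R) N :
  'E_P[(fun w => h (code N (X w)))]%E = (\sum_(b : N.-tuple bool) h b * law_code b)%:E.
Proof.
rewrite sum_indic_code expectation_sum => [|g /mapP[b _ ->]]; last exact: indic_code_Lfun.
rewrite big_map big_enum /= -sumEFin; apply: eq_bigr => b _.
have mA := measurable_RV_code N [set tval b].
rewrite expectationZl; last first.
  have := indic_code_Lfun (tval b) N 1; congr (_ \in Lfun P 1).
  by apply/funext => x /=; rewrite mulr1.
rewrite expectation_indic// EFinM /law_code size_tuple fineK//.
exact: fin_num_measure.
Qed.

(** Expectations of continuous functions depend only on the probabilities of
finite codes, up to an error that does not depend on the law of X. *)
Lemma expectation_approx (f : FNN -> R) (h : seq bool -> R) N (e M : R) :
  continuous f -> (forall x, `|f x| <= M) ->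
  (forall x, `|f x - h (code N x)| <= e) ->
  'E_P[f \o X]%E \is a fin_num /\
  `|fine 'E_P[f \o X]%E - \sum_(b : N.-tuple bool) h b * law_code b| <= e.
Proof.
move=> cf fM fh.
have mfX : measurable_fun setT (f \o X : T -> R).
  by apply: measurableT_comp (continuous_borel cf) (measurable_funP X).
have fL : (f \o X : T -> R) \in Lfun P 1 by apply: (bounded_Lfun mfX) => x; exact: fM.
have hL : (fun w => h (code N (X w))) \in Lfun P 1.
  apply: (@bounded_Lfun _ (M + e) (measurable_fun_code h N)) => x.
  rewrite -(subrK (f (X x)) (h _)) addrC (le_trans (ler_normD _ _))// lerD//.
  by rewrite distrC.
have fE := expectation_fin_num fL; split=> //.
have := expectation_code h N => hE.
have -> : fine 'E_P[f \o X]%E - \sum_(b : N.-tuple bool) h b * law_code b =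
    fine 'E_P[(f \o X) \- (fun w => h (code N (X w)))]%E.
  by rewrite expectationB// fineB ?hE.
apply: expectation_abs_le => [|x /=]; last exact: fh.
exact: rpredB.
Qed.

End CodeExpectation.

(** * A random variable with prescribed code probabilities *)

Section Decode.
Variable beta : nat -> bool.

(** The point with digits beta, if there is one: the value at i is the integer hit
at i, and infinity if there is none. *)
Definition decode : FNN := fun i =>
  match pselect (exists a : nat, beta (pickle (i, a))) with
  | left ex => Some (xchoose ex)
  | right _ => None
  end.

Hypothesis beta_code : forall N, exists x : FNN, code N x = mkseq beta N.

(** If every finite prefix of beta is the code of some point then at most one
integer is hit at each i, and repeated pairs carry equal digits. *)
Lemma code_decode N : code N decode = mkseq beta N.
Proof.
have common j k : exists x : FNN, hits (cell j) x = beta j /\ hits (cell k) x = beta k.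
  have [x xE] := beta_code (maxn j k).+1; exists x.
  have get i : (i < (maxn j k).+1)%N -> hits (cell i) x = beta i.
    by move=> iN; have := congr1 (fun s => nth false s i) xE; rewrite !nth_mkseq.
  by rewrite !get// ltnS ?leq_maxl ?leq_maxr.
apply: eq_mkseq => j /=; set q := cell j.
have bq : beta (pickle q) = beta j.
  by have [x [<- <-]] := common j (pickle q); rewrite cellK.
have unique (a a' : nat) : beta (pickle (q.1, a)) -> beta (pickle (q.1, a')) -> a = a'.
  have [x [<- <-]] := common (pickle (q.1, a)) (pickle (q.1, a')).
  by rewrite !cellK /hits /= => /eqP -> /eqP[].
rewrite /hits /decode -bq [in RHS](surjective_pairing q); case: pselect => [ex|nex].
  have /unique un := xchooseP ex.
  by apply/eqP/idP => [[<-]|/un ->]; first exact: xchooseP ex.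
by apply/esym/negbTE/negP => bq'; apply: nex; exists q.2.
Qed.

End Decode.

Lemma probability_setI_full (R : realType) d (T : measurableType d)
    (P : probability T R) (A I : set T) : measurable A -> measurable I ->
  P (~` I) = 0%E -> P A = P (A `&` I).
Proof.
move=> mA mI PI; have mIC := measurableC mI.
rewrite -{1}(setIT A) -(setUv I) setIUr measureU//; last 3 first.
- exact: measurableI.
- exact: measurableI.
- by rewrite setIACA setICr setI0.
rewrite (@subset_measure0 _ _ _ P (A `&` ~` I) (~` I))//; first by rewrite adde0.
exact: measurableI.
Qed.

Section Realization.
Variable R : realType.
Variable p : seq bool -> R.
Hypothesis p_nil : p [::] = 1.
Hypothesis p_ge0 : forall b, 0 <= p b.
Hypothesis p_split : forall b, p b = p (rcons b false) + p (rcons b true).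
Hypothesis p_code : forall b, p b != 0 -> exists x : FNN, code (size b) x = b.

(** The left end of the interval of b: its subintervals of digits 0 and 1 are
placed in this order, so each digit 1 adds the mass of its sibling. *)
Definition low (b : seq bool) : R :=
  \sum_(j < size b | nth false b j) p (rcons (take j b) false).

Lemma low_rcons b x : low (rcons b x) = low b + (if x then p (rcons b false) else 0).
Proof.
rewrite /low size_rcons big_mkcond big_ord_recr /= nth_rcons ltnn eqxx -cats1 take_size_cat//.
congr (_ + _); rewrite [RHS]big_mkcond; apply: eq_bigr => j _.
by rewrite nth_cat ltn_ord takel_cat// ltnW.
Qed.

Lemma low_bounds b : 0 <= low b /\ low b + p b <= 1.
Proof.
elim/last_ind: b => [|b x [lb ub]].
  by rewrite /low big_ord0 p_nil add0r.
have := p_split b; have := p_ge0 (rcons b false); have := p_ge0 (rcons b true).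
rewrite low_rcons; case: x; lra.
Qed.

(** For w in [0, 1[, the word b of length n whose interval contains w. *)
Fixpoint digits (w : R) n : seq bool :=
  if n is n'.+1 then
    let b := digits w n' in rcons b (low b + p (rcons b false) <= w)
  else [::].

Definition digit w n : bool :=
  low (digits w n) + p (rcons (digits w n) false) <= w.

Lemma digitsE w n : digits w n = mkseq (digit w) n.
Proof. by elim: n => //= n IH; rewrite mkseqS -IH. Qed.

(** The intervals [low b, low b + p b[ of the words b of a given length partition
[0, 1[. *)
Lemma digitsP w b : 0 <= w < 1 ->
  (digits w (size b) == b) = (low b <= w < low b + p b).
Proof.
move=> w01; elim/last_ind: b => [|b x IH].
  by rewrite eqxx /low big_ord0 p_nil add0r.
rewrite size_rcons /= eqseq_rcons IH low_rcons.
have := p_split b; have := p_ge0 (rcons b false); have := p_ge0 (rcons b true).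
move=> p1 p0 ps; have [IHb|nb] := boolP (digits w (size b) == b).
  move: IH; rewrite IHb (eqP IHb) => /esym/andP[l u].
  case: x; rewrite ?addr0 ?eqb_id ?eqbF_neg -?ltNge; apply/idP/idP; lra.
rewrite (negPf nb) in IH; rewrite -IH /=; apply/esym/negbTE/negP => H.
have : low b <= w < low b + p b by move: H; case: (x); rewrite ?addr0; lra.
by rewrite -IH.
Qed.

(** Intervals are half-open, so a w in [0, 1[ only meets words of positive mass, and
these are codes of points; no exceptional null set arises inside [0, 1[. *)
Definition realization (w : R) : FNN :=
  if 0 <= w < 1 then decode (digit w) else (fun=> None).

Lemma code_realization w N : 0 <= w < 1 -> code N (realization w) = digits w N.
Proof.
move=> w01; rewrite /realization w01 digitsE; apply: code_decode => M.
have sM : size (digits w M) = M by rewrite digitsE size_mkseq.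
have := digitsP (digits w M) w01; rewrite sM eqxx => /esym wI.
by rewrite -digitsE -[in code M]sM; apply: p_code; apply: lt0r_neq0; lra.
Qed.

Lemma realization_codeE b :
  realization @^-1` (code (size b) @^-1` [set b]) `&` `[0, 1[ =
  `[low b, low b + p b[%classic.
Proof.
apply/seteqP; split => w /=; rewrite !in_itv /=.
  by move=> [+ w01]; rewrite code_realization// => /eqP; rewrite digitsP.
move=> wb; have [l0 u1] := low_bounds b.
have w01 : 0 <= w < 1 by lra.
by split=> //; rewrite code_realization//; apply/eqP; rewrite digitsP.
Qed.

Lemma uniform_prob_itvco (l r : R) : 0 <= l -> l <= r -> r <= 1 ->
  uniform_prob (@ltr01 R) `[l, r[%classic = (r - l)%:E.
Proof.
move=> l0 lr r1; rewrite /uniform_prob (eq_integral (fun=> 1%:E)) => [|x]; last first.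
  rewrite inE /= in_itv /= => xlr; rewrite /uniform_pdf.
  by rewrite subr0 invr1 (_ : 0 <= x <= 1); [|lra].
rewrite integral_cst//= mul1e lebesgue_measure_itv /= lte_fin.
by move: lr; rewrite le_eqVlt => /predU1P[->|->//]; rewrite ltxx subrr.
Qed.

Lemma measurable_realization_code b :
  measurable (realization @^-1` (code (size b) @^-1` [set b])).
Proof.
set A := _ @^-1` _; rewrite -(setIT A) -(setvU `[0, 1[%classic) setIUr.
apply: measurableU; last first.
  by rewrite realization_codeE; exact: measurable_itv.
have [e|ne] := eqVneq (code (size b) (fun=> None)) b.
  rewrite setIidr => [|w /=]; first by apply: measurableC; exact: measurable_itv.
  by rewrite in_itv /= => /negP nw; rewrite /A /= /realization (negPf nw).
suff -> : A `&` ~` `[0, 1[ = set0 by exact: measurable0.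
rewrite -subset0 => w [/= + /negP nw]; rewrite in_itv /= in nw.
by rewrite /A /= /realization (negPf nw) => e; rewrite e eqxx in ne.
Qed.

Lemma measurable_realization :
  measurable_fun [set: R] (realization : R -> borel FNN).
Proof.
apply: (@measurability _ _ _ (borel FNN) _ _ (@open FNN)) => //.
move=> _ [U oU <-]; rewrite setTI (open_bigcup_code oU) preimage_bigcup.
apply: bigcupT_measurable => N.
set B := [set x : FNN | _].
have -> : realization @^-1` B = \bigcup_(b : seq bool)
    (if `[< size b = N /\ exists2 y : FNN, code N y = b &
          [set z : FNN | code N z = code N y] `<=` U >]
     then realization @^-1` (code (size b) @^-1` [set b]) else set0).
  apply/seteqP; split => [w [y yw yU]|w [b _]].
    exists (code N (realization w)) => //; rewrite asboolT; last first.
      by rewrite size_code; split=> //; exists y.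
    by rewrite /= size_code.
  case: asboolP => // -[sb [y yb yU]] /= wb.
  by exists y => //; rewrite yb -wb sb.
apply: countable_bigcupT_measurable => [|b]; first exact: countableP.
case: asboolP => _; last exact: measurable0.
exact: measurable_realization_code.
Qed.

(** On [0, 1[ the event is the interval of b, of length p b, and the rest has
mass 0. *)
Lemma uniform_prob_realization b :
  uniform_prob (@ltr01 R) (realization @^-1` (code (size b) @^-1` [set b])) = (p b)%:E.
Proof.
have [l0 u1] := low_bounds b; have pb := p_ge0 b.
set A := realization @^-1` _.
have mA : measurable A by exact: measurable_realization_code.
have mI : measurable (`[0, 1[%classic : set R) by exact: measurable_itv.
have PI : uniform_prob (@ltr01 R) `[0, 1[%classic = 1%E.
  by rewrite uniform_prob_itvco ?subr0.
have PIC : uniform_prob (@ltr01 R) (~` `[0, 1[%classic) = 0%E.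
  by rewrite probability_setC// [X in (1 - X)%E]PI subee.
transitivity (uniform_prob (@ltr01 R) (A `&` `[0, 1[%classic)).
  pose U : probability (measurableTypeR R) R := uniform_prob (@ltr01 R).
  exact: (@probability_setI_full R _ _ U A _ mA mI PIC).
rewrite realization_codeE uniform_prob_itvco//; [|lra].
by congr (_%:E); lra.
Qed.

End Realization.

(** * Convergence in distribution from convergence on cylinders *)

Lemma measurable_hits_seq (s : seq (nat * nat)) (B : set (seq bool)) :
  measurable ([set x : FNN | B [seq hits q x | q <- s]] : set (borel FNN)).
Proof.
apply: sub_sigma_algebra; rewrite /= openE => x /= Bx.
suff : nbhs x [set y : FNN | [seq hits q y | q <- s] = [seq hits q x | q <- s]].
  by apply: filterS => y /= ->.
elim: s {Bx} => [|q s IH]; first by apply: filterS (filterT : nbhs x setT) => y _.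
by apply: filterS (filterI IH (nbhs_hits q x)) => y [/= -> ->].
Qed.

Lemma code_map N (x : FNN) : code N x = [seq hits q x | q <- [seq cell j | j <- iota 0 N]].
Proof. by rewrite /code /mkseq -map_comp. Qed.

Lemma eq_cvgn (R : realType) (u v : nat -> R) : u =1 v -> cvgn u -> cvgn v.
Proof. by move=> /funext ->. Qed.

Section CylinderCriterion.
Variables (R : realType) (d : nat -> measure_display).
Variables (T : forall n, measurableType (d n)) (P : forall n, probability (T n) R).
Variable X : forall n, {RV P n >-> borel FNN}.

Hypothesis cvg_cylinder : forall m : seq (nat * nat),
  cvgn (fun n => fine (P n (X n @^-1` [set x | all (hits^~ x) m]))).

(** Inclusion and exclusion, one digit at a time: the event that a digit is 0 is the
complement of the event that it is 1, and the latter only enlarges the cylinder m. *)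
Lemma cvg_pattern (m s : seq (nat * nat)) (b : seq bool) :
  cvgn (fun n => fine (P n (X n @^-1`
    [set x | all (hits^~ x) m && ([seq hits q x | q <- s] == b)]))).
Proof.
have m0 A : A = set0 -> cvgn (fun n => fine (P n (X n @^-1` A)) : R).
  move=> ->; under eq_fun do rewrite preimage_set0 measure0.
  exact: is_cvg_cst.
have mE (mm ss : seq (nat * nat)) bb n :
    measurable (X n @^-1` [set x | all (hits^~ x) mm && ([seq hits q x | q <- ss] == bb)]).
  rewrite -[X in measurable X]setTI; apply: (measurable_funP (X n)) => //.
  have -> : [set x : borel FNN | all (hits^~ x) mm && ([seq hits q x | q <- ss] == bb)] =
    [set x : FNN | all id [seq hits q x | q <- mm]] `&`
    [set x : FNN | [seq hits q x | q <- ss] = bb].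
    apply/seteqP; split => x /=; rewrite all_map; first by move=> /andP[? /eqP].
    by move=> [-> ->]; rewrite eqxx.
  apply: measurableI; first exact: (measurable_hits_seq mm [set l | all id l]).
  exact: (measurable_hits_seq ss [set bb]).
elim: s m b => [|q s IH] m [|x b].
- by apply: eq_cvgn (@cvg_cylinder m) => n; congr (fine (P n (X n @^-1` _)));
    apply/seteqP; split => z /=; rewrite eqxx andbT.
- by apply: m0; rewrite -subset0 => z /=; rewrite andbF.
- by apply: m0; rewrite -subset0 => z /=; rewrite andbF.
case: x.
  apply: eq_cvgn (IH (q :: m) b) => n; congr (fine (P n (X n @^-1` _))).
  by apply/seteqP; split => z /=; rewrite eqseq_cons eqb_id; case: (hits q z); rewrite ?andbF.
apply: eq_cvgn (is_cvgB (IH m b) (IH (q :: m) b)) => n; rewrite !fctE /=.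
set A := X n @^-1` _; set B := X n @^-1` _; set C := X n @^-1` _.
have -> : A = B `|` C.
  by apply/seteqP; split => z; rewrite /A /B /C /= eqseq_cons eqbF_neg;
    case: (hits q (X n z)) => /=; rewrite ?andbF ?andFb; intuition.
have BC0 : B `&` C = set0.
  by rewrite -subset0 => z; rewrite /B /C /= eqseq_cons eqbF_neg;
    case: hits => -[]; rewrite /= ?andbF.
have mB : measurable B by exact: (mE (q :: m) s b).
have mC : measurable C by exact: (mE m (q :: s) (false :: b)).
by rewrite measureU// fineD ?fin_num_measure// addrAC subrr add0r.
Qed.

Lemma cvg_law_code b : cvgn (fun n => law_code (X n) b).
Proof.
apply: eq_cvgn (@cvg_pattern [::] [seq cell j | j <- iota 0 (size b)] b) => n.
rewrite /law_code; congr (fine (P n (X n @^-1` _))).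
by apply/seteqP; split => x /=; rewrite -code_map => /eqP.
Qed.

Definition limit_law b : R := limn (fun n => law_code (X n) b).

Lemma limit_law_nil : limit_law [::] = 1.
Proof.
rewrite /limit_law (_ : (fun n => _) = (fun=> 1)) ?lim_cst//.
apply/funext => n; rewrite /law_code (_ : _ @^-1` _ = setT) ?probability_setT//.
by apply/seteqP; split.
Qed.

Lemma law_code_ge0 n b : 0 <= law_code (X n) b.
Proof. by rewrite /law_code fine_ge0. Qed.

Lemma limit_law_ge0 b : 0 <= limit_law b.
Proof.
apply: limr_ge; first exact: cvg_law_code.
by apply: nearW => n; exact: law_code_ge0.
Qed.

Lemma law_code_split n b :
  law_code (X n) b = law_code (X n) (rcons b false) + law_code (X n) (rcons b true).
Proof.
rewrite /law_code -fineD ?fin_num_measure//; try exact: measurable_RV_code.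
rewrite -measureU//; try exact: measurable_RV_code.
  congr (fine (P n _)); apply/seteqP; split => w /=; rewrite !size_rcons !codeS.
    by move=> ->; case: hits; [right|left].
  by case=> /eqP; rewrite eqseq_rcons => /andP[/eqP].
rewrite -subset0 => w [] /=; rewrite !size_rcons !codeS => /eqP + /eqP.
by rewrite !eqseq_rcons => /andP[_ /eqP ->] /andP[_].
Qed.

Lemma limit_law_split b :
  limit_law b = limit_law (rcons b false) + limit_law (rcons b true).
Proof.
rewrite /limit_law -limD; [|exact: cvg_law_code|exact: cvg_law_code].
by congr (limn _); apply/funext => n; rewrite law_code_split.
Qed.

(** A word that is the code of no point has probability 0 for every n. *)
Lemma limit_law_code b : limit_law b != 0 -> exists x : FNN, code (size b) x = b.
Proof.
move=> nz; apply: contrapT => nx; move/eqP: nz; apply.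
rewrite /limit_law (_ : (fun n => _) = (fun=> 0)) ?lim_cst//.
apply/funext => n; rewrite /law_code (_ : _ @^-1` _ = set0) ?measure0//.
by rewrite -subset0 => w /= e; apply: nx; exists (X n w).
Qed.

(** Existence and convergence hold together: the limits of the probabilities of
codes are consistent and are realized on [0, 1[; a continuous function is within
e / 3 of a function of the code, whose expectation is a finite sum of these
probabilities. *)
Theorem cvg_in_distribution_of_cylinders :
  exists (d' : measure_display) (T' : measurableType d') (P' : probability T' R)
    (Y : {RV P' >-> borel FNN}), cvg_in_distribution X Y.
Proof.
have mY := measurable_realization limit_law_nil limit_law_ge0 limit_law_split
  limit_law_code.
pose P' : probability (measurableTypeR R) R := uniform_prob (@ltr01 R).
pose Yf : measurableTypeR R -> borel FNN := realization limit_law.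
pose Y : {RV P' >-> borel FNN} := HB.pack Yf (isMeasurableFun.Build _ _ _ _ Yf mY).
exists _, _, P', Y.
move=> f cf [M0 [M0r fM0]].
have fM x : `|f x| <= M0 + 1 by apply: fM0 => //; rewrite ltrDl.
(* A point with code b, at which f is evaluated to approximate f on that class. *)
pose rep (b : seq bool) : FNN := get [set x | code (size b) x = b].
have repP x N : code N (rep (code N x)) = code N x.
  have : [set y | code (size (code N x)) y = code N x] (rep (code N x)).
    by apply: getPex; exists x; rewrite /= size_code.
  by rewrite /= size_code.
have Ylaw b : law_code Y b = limit_law b.
  rewrite /law_code.
  by rewrite [X in fine X](uniform_prob_realization limit_law_nil limit_law_ge0
    limit_law_split limit_law_code b).
have unif e : 0 < e -> exists N, forall x, `|f x - f (rep (code N x))| <= e.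
  by move=> /(uniform_code cf)[N fN]; exists N => x; apply: fN; rewrite repP.
have [N1 fN1] := unif 1 ltr01.
have [finY _] := expectation_approx (h := f \o rep) Y cf fM fN1.
rewrite -(fineK finY); apply/fine_cvgP; split.
  apply: nearW => n.
  by have [] := expectation_approx (h := f \o rep) (X n) cf fM fN1.
apply/cvgrPdist_le => e e0.
have e3 : 0 < e / 3 by rewrite divr_gt0.
have [N fN] := unif _ e3.
have [_ approxY] := expectation_approx (h := f \o rep) Y cf fM fN.
pose S n := \sum_(b : N.-tuple bool) f (rep b) * law_code (X n) b.
pose S' := \sum_(b : N.-tuple bool) f (rep b) * limit_law b.
have cS : S n @[n --> \oo] --> S'.
  apply: cvg_big => [|b _]; first exact: add_continuous.
  apply: cvgM; first exact: cvg_cst.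
  exact: cvg_law_code.
have /cvgrPdist_le/(_ _ e3) := cS.
apply: filterS => n SS /=.
have [_ approxX] := expectation_approx (h := f \o rep) (X n) cf fM fN.
rewrite -/(S n) in approxX.
have YS : \sum_(b : N.-tuple bool) f (rep b) * law_code Y b = S'.
  by apply: eq_bigr => b _; rewrite Ylaw.
rewrite YS in approxY.
move: approxX approxY SS; set EX := fine _; set EY := fine _ => aX aY SS.
have -> : EY - EX = (EY - S') + (S' - S n) - (EX - S n) by lra.
have -> : e = e / 3 + e / 3 + e / 3 by lra.
by rewrite (le_trans (ler_normB _ _))// lerD// (le_trans (ler_normD _ _))// lerD.
Qed.

End CylinderCriterion.

(** * Random avoiders *)

Lemma hits_perm_fun n (pi : 'S_n) q : (q.1 < n)%N ->
  hits q (perm_fun pi) = (onth (vals pi) q.1 == Some q.2).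
Proof.
move=> qn; rewrite /hits /perm_fun insubT.
apply/eqP/onth_valsP => [[<-]|[j [jq jv]]]; first by exists (Ordinal qn).
by congr Some; rewrite -jv; congr (nat_of_ord (pi _)); apply: val_inj.
Qed.

Lemma uniform_on_prob (R : realType) n d (T : measurableType d)
    (P : probability T R) (X : {RV P >-> 'S_n}) (A : {set 'S_n}) (C : pred 'S_n) :
  uniform_on X A ->
  P (X @^-1` [set pi | C pi]) = ((\sum_(pi in A) (C pi)%:R) / #|A|%:R)%:E.
Proof.
move=> uX.
have -> : P (X @^-1` [set pi | C pi]) =
    distribution P X (\bigcup_(pi in [set` C]) [set pi]).
  by rewrite /distribution /pushforward; congr (P (X @^-1` _)); apply/seteqP; split
    => [w Cw|w [pi Cpi ->]] //; exists w.
rewrite measure_fin_bigcup//; last by move=> i j _ _ [x [-> ->]].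
rewrite -(bigfs _ (r := index_enum {perm 'I_n})) ?index_enum_uniq//; last first.
  by move=> i _; rewrite mem_index_enum.
rewrite mulr_suml -sumEFin big_mkcond [RHS]big_mkcond; apply: eq_bigr => pi _.
case: (C pi) => /=; last by rewrite mul0r if_same.
by apply: etrans (uX pi) _; rewrite mul1r; case: (pi \in A).
Qed.

Theorem theorem1 (R : realType) (sigma : 'S_3)
    (d : nat -> measure_display) (T : forall n : nat, measurableType (d n))
    (P : forall n : nat, probability (T n) R)
    (Pi : forall n : nat, {RV (P n) >-> 'S_n})
    (hPi : forall n : nat, (4 <= n)%N -> uniform_on (Pi n) (Av n sigma)) :
  exists (d' : measure_display) (T' : measurableType d')
    (P' : probability T' R) (Pi' : {RV P' >-> borel FNN}),
    cvg_in_distribution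
      (fun n : nat => (@perm_fun n \o Pi n : {RV (P n) >-> borel FNN})) Pi'.
Proof.
apply: cvg_in_distribution_of_cylinders => m.
have := @Av_matches_cvg R sigma m => c; apply: (cvgP _ (cvg_trans _ c)).
apply: near_eq_cvg; exists (maxn 4 (\max_(q <- m) q.1).+1) => // n /=.
rewrite geq_max => /andP[n4 mn]; symmetry.
have := uniform_on_prob (fun pi => matches m (vals pi)) (hPi n n4) => /= uP.
rewrite (_ : _ @^-1` _ = Pi n @^-1` [set pi | matches m (vals pi)]) ?uP//.
apply/seteqP; split => w /=; rewrite /matches; congr is_true;
  apply: eq_in_all => q qm; rewrite hits_perm_fun//; exact: leq_trans (fst_lt_max qm) mn.
Qed.
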